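(* Let $q\in\mathbb N_1$. For every $\theta>0$, every Borel probability measure $\nu$ on $\Delta^{q-1}$ and every $j\in[q]$, $$\mathrm E_{\Pi_{\theta,\nu}}[D_j]=m_{\mathbf e_j}(\nu),\qquad \mathrm{Var}_{\Pi_{\theta,\nu}}[D_j]=\frac{\mathrm{Var}_\nu[u_j]}{\theta+1},$$ where $D_j(\mathbf x)=\sum_{i\ge0}x_{i,j}$ for $\mathbf x\in\boldsymbol\nabla^{(q)}_0$ and $u_j$ is the $j$-th coordinate function on $\Delta^{q-1}$. Consequently, $\mathscr E^\bullet_{\theta,\nu}=(\mathscr E^n_{\theta,\nu})_{n\ge0}$ is of partially exchangeable type if and only if $\nu=\delta_{\mathbf p}$ for some $\mathbf p\in\Delta^{q-1}$.
   Context: Notation: $\mathbb N_1=\{1,2,\dots\}$, $\mathbb N_0=\{0,1,\dots\}$, $[q]=\{1,\dots,q\}$, $\mathbb N^q_*=\mathbb N_0^q\setminus\{\mathbf 0\}$, $0^0=1$; $|\mathbf a|=\sum_j|a_j|$, $\mathbf a!=\prod_ja_j!$, $\mathbf x^{\mathbf a}=\prod_jx_j^{a_j}$, $\binom{|\mathbf a|}{\mathbf a}=|\mathbf a|!/\mathbf a!$; $\mathbf e_j$ canonical basis vectors; $\langle\theta\rangle_n=\theta(\theta+1)\cdots(\theta+n-1)$; $\Delta^{q-1}=\{\mathbf u\in[0,1]^q:|\mathbf u|=1\}$; $m_{\mathbf a}(\nu)=\int\mathbf u^{\mathbf a}d\nu(\mathbf u)$. A $q$-chromatic partition of $n$ is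 a finitely supported map $A\colon\mathbb N^q_*\to\mathbb N_0$ with $\sum_{\mathbf a}A(\mathbf a)|\mathbf a|=n$; $\mathcal A^{(q)}_n$ is the set of these; for $\mathbf n\in\mathbb N_0^q$, $\mathcal A_{\mathbf n}=\{A:\sum_{\mathbf a}A(\mathbf a)\mathbf a=\mathbf n\}$. $\mathbf 1_{\mathbf a}$ is the multiset with single element $\mathbf a$; operations pointwise. pESF: $\mathscr E^n_{\theta,\nu}[A]=\frac{n!}{\langle\theta\rangle_n}\prod_{\mathbf a\in\mathrm{supp}A}\frac1{A(\mathbf a)!}\big(\frac{\theta}{|\mathbf a|}\binom{|\mathbf a|}{\mathbf a}m_{\mathbf a}(\nu)\big)^{A(\mathbf a)}$, $A\in\mathcal A^{(q)}_n$ (a probability on $\mathcal A^{(q)}_n$). For $\mathbf a\in\mathrm{supp}A$, $a_j\ge1$: $A_{\setminus\mathbf a,j}=A-\mathbf 1_{\mathbf a}$ if $\mathbf a=\mathbf e_j$, else $A-\mathbf 1_{\mathbf a}+\mathbf 1_{\mathbf a-\mathbf e_j}$. A partially exchangeable partition structure is a family $(Q_{\mathbf n})_{\mathbf n\in\mathbb N_0^q}$ of probability measures $Q_{\mathbf n}$ on $\mathcal A_{\mathbf n}$ with $Q_{\mathbf n-\mathbf e_j}[B]=\sum_{A\in\mathcal A_{\mathbf n}}Q_{\mathbf n}[A]S^j_{\mathbf n}(A,B)$ for all $\mathbf n$, all $j$ with $n_j\ge1$ and all $B\in\mathcal A_{\mathbf n-\mathbf e_j}$, where $S^j_{\mathbf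 n}(A,B)=a_jA(\mathbf a)/n_j$ if $B=A_{\setminus\mathbf a,j}$, and $0$ otherwise. A sequence $(P_n)_{n\ge0}$ of probabilities on $\mathcal A^{(q)}_n$ (consistent under uniform deletion of one element) is of partially exchangeable type if there are $\mathbf p\in\Delta^{q-1}$ and such a family $(Q_{\mathbf n})$ with $P_n=\sum_{\mathbf n\in\mathbb N_0^q:|\mathbf n|=n}\binom n{\mathbf n}\mathbf p^{\mathbf n}Q_{\mathbf n}$ for all $n\in\mathbb N_0$. Kingman simplex: $\mathbf s<_{\mathrm{sl}}\mathbf t$ iff $(|\mathbf s|,s_1,\dots,s_q)<(|\mathbf t|,t_1,\dots,t_q)$ lexicographically. $\boldsymbol\nabla^{(q)}_0$ is the set of sequences $\mathbf x=(\mathbf x_i)_{i\ge0}$, $\mathbf x_i=(x_{i,1},\dots,x_{i,q})\in[0,\infty)^q$, with $\mathbf x_i\ge_{\mathrm{sl}}\mathbf x_{i+1}$ for $i\ge1$, $\sum_{i\ge0}|\mathbf x_i|=1$. $\Pi_{\theta,\nu}$ is the law on $\boldsymbol\nabla^{(q)}_0$ of $(\mathbf x_0,\mathbf x_1,\dots)$ with $\mathbf x_0=\mathbf 0$ and $\mathbf x_i=\ell_i\mathbf p_i$, $i\ge1$, where $\ell_1\geq\ell_2\geq\cdots$ has the Poisson–Dirichlet distribution with parameter $\theta$ (the law of the decreasing rearrangement of $V_1,(1-V_1)V_2,(1-V_1)(1-V_2)V_3,\dots$ with $V_i$ i.i.d. Beta$(1,\theta)$), and $(\mathbf p_i)_{i\ge1}$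 are i.i.d. with law $\nu$, independent of $(\ell_i)_i$. *)

(* Defs.v *)
From HB Require Import structures.
From mathcomp Require Import all_boot all_order all_algebra finmap.
From mathcomp Require Import all_classical all_reals all_analysis.

Set Implicit Arguments.
Unset Strict Implicit.
Unset Printing Implicit Defensive.

Import Order.TTheory GRing.Theory Num.Theory.
Import numFieldNormedType.Exports.

Local Open Scope classical_set_scope.
Local Open Scope ring_scope.

Definition mindex (q : nat) := {ffun 'I_q -> nat}.

Definition mnorm (q : nat) (a : mindex q) : nat := (\sum_j a j)%N.

Definition midx0 (q : nat) : mindex q := [ffun=> 0%N].

Definition munit (q : nat) (j : 'I_q) : mindex q := [ffun i => (i == j) : nat].

(* Only used when [0 < a j], where the truncated subtraction is exact. *)
Definition mpred (q : nat) (a : mindex q) (j : 'I_q) : mindex q :=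
  [ffun i => (a i - (i == j))%N].

Definition multinomial (R : realType) (q : nat) (a : mindex q) : R :=
  ((mnorm a)`!)%:R / (\prod_j (a j)`!)%:R.

(* Finitely supported maps are defined on all of N^q; that such a map lives on
   N^q minus the origin is expressed by its vanishing at [midx0 q], which is
   part of the definitions of [parts] and [parts_color] below. *)
Definition cpart (q : nat) := {fsfun mindex q -> nat with 0%N}.

Definition parts (q n : nat) : set (cpart q) :=
  [set A : cpart q | A (midx0 q) = 0%N /\
           (\sum_(a <- finsupp A) A a * mnorm a)%N = n].

Definition parts_color (q : nat) (n : mindex q) : set (cpart q) :=
  [set A : cpart q | A (midx0 q) = 0%N /\
           forall j, (\sum_(a <- finsupp A) A a * a j)%N = n j].

(* The partition obtained from [A] by deleting an element of colour [j] from a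
   block of type [a]. *)
Definition delete (q : nat) (A : cpart q) (a : mindex q) (j : 'I_q) : cpart q :=
  let A1 : cpart q := [fsfun A with a |-> (A a).-1] in
  if a == munit j then A1
  else [fsfun A1 with mpred a j |-> (A1 (mpred a j)).+1].

(* The sum has at most one term, since [A], [j] and [delete A a j] determine
   [a]. *)
Definition color_deletion (R : realType) (q : nat) (n : mindex q) (j : 'I_q)
    (A B : cpart q) : R :=
  \sum_(a <- finsupp A | (0 < a j)%N && (B == delete A a j))
     (a j * A a)%:R / (n j)%:R.

Definition uniform_deletion (R : realType) (q n : nat) (A B : cpart q) : R :=
  \sum_(j < q) \sum_(a <- finsupp A | (0 < a j)%N && (B == delete A a j))
     (a j * A a)%:R / n%:R.

(* All the sets [S] this is used with are finite. *)
Definition is_pmf (R : realType) (T : choiceType) (S : set T) (Q : T -> R) :=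
  [/\ forall A, 0 <= Q A, forall A, ~ S A -> Q A = 0
    & \sum_(A \in S) Q A = 1].

Definition partition_structure (R : realType) (q : nat)
    (P : nat -> cpart q -> R) : Prop :=
  (forall n, is_pmf (@parts q n) (P n)) /\
  (forall n (B : cpart q), parts n B ->
     P n B = \sum_(A \in @parts q n.+1) P n.+1 A * uniform_deletion R n.+1 A B).

Definition partially_exchangeable_structure (R : realType) (q : nat)
    (Q : mindex q -> cpart q -> R) : Prop :=
  (forall n, is_pmf (parts_color n) (Q n)) /\
  (forall (n : mindex q) (j : 'I_q), (0 < n j)%N ->
     forall B : cpart q, parts_color (mpred n j) B ->
     Q (mpred n j) B =
       \sum_(A \in parts_color n) Q n A * color_deletion R n j A B).

(* The number of colours is [k.+1], so that the simplex is inhabited, as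
   required of a [measurableType]. *)

Definition l1norm (R : realType) (q : nat) (u : 'rV[R]_q) : R :=
  \sum_j `|u 0 j|.

Definition in_simplex (R : realType) (k : nat) : set 'rV[R]_k.+1 :=
  [set u : 'rV[R]_k.+1 | (forall j, 0 <= u 0 j <= 1) /\ l1norm u = 1].

Definition simplex_pts (R : realType) (k : nat) := set_type (@in_simplex R k).
HB.instance Definition _ (R : realType) (k : nat) :=
  Choice.on (simplex_pts R k).

Lemma delta_in_simplex (R : realType) (k : nat) :
  (delta_mx 0 0 : 'rV[R]_k.+1) \in @in_simplex R k.
Proof.
rewrite inE; split=> [j|].
  by rewrite mxE eqxx /=; case: (j == 0); rewrite !(lexx, ler01).
rewrite /l1norm (bigD1 0) //= big1 ?addr0 => [|j /negPf j0].
  by rewrite mxE !eqxx normr1.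
by rewrite mxE j0 andbF normr0.
Qed.

HB.instance Definition _ (R : realType) (k : nat) :=
  isPointed.Build (simplex_pts R k) (exist (fun x => x \in @in_simplex R k) _ (delta_in_simplex R k)).

Definition simplex_open (R : realType) (k : nat) : set (set (simplex_pts R k)) :=
  [set O | exists2 U : set 'rV[R]_k.+1, open U & O = [set u | U (val u)]].

Definition simplex (R : realType) (k : nat) :=
  g_sigma_algebraType (@simplex_open R k).

Definition ucoord (R : realType) (k : nat) (u : simplex R k) (j : 'I_k.+1) : R :=
  (val (u : simplex_pts R k)) 0 j.

HB.instance Definition _ (R : realType) (k : nat) :=
  Measurable.on (simplex R k).

Definition moment (R : realType) (k : nat)
    (nu : probability (simplex R k) R) (a : mindex k.+1) : R :=
  (\int[nu]_u \prod_j (ucoord u j ^+ a j))%R.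

Definition rising (R : realType) (theta : R) (n : nat) : R :=
  \prod_(i < n) (theta + i%:R).

Definition pESF (R : realType) (k : nat) (theta : R)
    (nu : probability (simplex R k) R) (n : nat) (A : cpart k.+1) : R :=
  if A \in @parts k.+1 n then
    (n`!)%:R / rising theta n *
    \prod_(a <- finsupp A)
      (((A a)`!)%:R^-1 *
       (theta / (mnorm a)%:R * multinomial R a * moment nu a) ^+ A a)
  else 0.

Definition partially_exchangeable_type (R : realType) (k : nat)
    (P : nat -> cpart k.+1 -> R) : Prop :=
  partition_structure P /\
  exists (p : simplex R k) (Q : mindex k.+1 -> cpart k.+1 -> R),
    partially_exchangeable_structure Q /\
    forall n A,
      P n A = \sum_(m \in [set m : mindex k.+1 | mnorm m = n])
                multinomial R m * (\prod_j ucoord p j ^+ m j) * Q m A.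

Definition sl_key (R : realType) (q : nat) (s : 'rV[R]_q) : seqlexi R :=
  l1norm s :: [seq s 0 j | j <- enum 'I_q].

Definition in_kingman (R : realType) (k : nat) : set (nat -> 'rV[R]_k.+1) :=
  [set x : nat -> 'rV[R]_k.+1 | [/\ forall i j, 0 <= x i 0 j,
               forall i, (0 < i)%N -> (sl_key (x i.+1) <= sl_key (x i))%O
             & series (fun i => l1norm (x i)) @ \oo --> (1 : R)]].

Definition kingman_pts (R : realType) (k : nat) := set_type (@in_kingman R k).
HB.instance Definition _ (R : realType) (k : nat) :=
  Choice.on (kingman_pts R k).

Lemma delta_in_kingman (R : realType) (k : nat) :
  (fun i => if i is 0%N then delta_mx 0 0 else 0 : 'rV[R]_k.+1)
    \in @in_kingman R k.
Proof.
rewrite inE; split=> [[|i] j|[|i]//|].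
- by rewrite mxE eqxx /=; case: (_ == _); rewrite ?(lexx, ler01).
- by rewrite mxE.
apply: cvg_near_cst; exists 1%N => //= -[//|n] _.
have [_ n1] := set_mem (delta_in_simplex R k).
rewrite /series /= big_nat_recl //= n1 big1 ?addr0 // => i _.
by rewrite /l1norm big1 // => j _; rewrite mxE normr0.
Qed.

HB.instance Definition _ (R : realType) (k : nat) :=
  isPointed.Build (kingman_pts R k) (exist (fun x => x \in @in_kingman R k) _ (delta_in_kingman R k)).

Definition kingman_cylinder (R : realType) (k : nat) :
    set (set (kingman_pts R k)) :=
  [set C | exists i j (B : set R), measurable B /\ C = [set x : kingman_pts R k | B (val x i 0 j)]].

Definition kingman (R : realType) (k : nat) :=
  g_sigma_algebraType (@kingman_cylinder R k).

HB.instance Definition _ (R : realType) (k : nat) :=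
  Measurable.on (kingman R k).

Definition kcoord (R : realType) (k : nat) (x : kingman R k) (i : nat) :
    'rV[R]_k.+1 :=
  val (x : kingman_pts R k) i.

Definition colour_mass (R : realType) (k : nat) (j : 'I_k.+1)
    (x : kingman R k) : R :=
  limn (series (fun i => kcoord x i 0 j)).

Definition seq_cylinder d (T : measurableType d) : set (set (nat -> T)) :=
  [set C | exists n (B : set T), measurable B /\ C = [set x : nat -> T | B (x n)]].

Definition seqspace d (T : measurableType d) :=
  g_sigma_algebraType (@seq_cylinder d T).

HB.instance Definition _ d (T : measurableType d) :=
  Measurable.on (seqspace T).

(* Equality of laws is asserted on measurable sets only: measures are functions
   on all sets, whose values on non-measurable sets are irrelevant. *)
Definition same_law d (T : measurableType d) (R : realType)
    (mu nu : set T -> \bar R) : Prop :=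
  forall A, measurable A -> mu A = nu A.

Definition mutually_independent d d' (Omega : measurableType d)
    (T : measurableType d') (R : realType) (P : probability Omega R)
    (X : nat -> Omega -> T) : Prop :=
  forall (J : {fset nat}) (B : nat -> set T), (forall i, measurable (B i)) ->
    P (\bigcap_(i in [set` J]) X i @^-1` B i) =
    (\prod_(i <- J) P (X i @^-1` B i))%E.

Definition independent d d1 d2 (Omega : measurableType d)
    (T1 : measurableType d1) (T2 : measurableType d2) (R : realType)
    (P : probability Omega R) (X : Omega -> T1) (Y : Omega -> T2) : Prop :=
  forall (A : set T1) (B : set T2), measurable A -> measurable B ->
    P (X @^-1` A `&` Y @^-1` B) = (P (X @^-1` A) * P (Y @^-1` B))%E.

Definition beta_kernel (R : realType) (a b t : R) : R :=
  t `^ (a - 1) * (1 - t) `^ (b - 1).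

(* The library's [beta_prob] only has natural number parameters. *)
Definition beta_law (R : realType) (a b : R) (A : set R) : \bar R :=
  ((\int[lebesgue_measure]_(t in A `&` `]0%R, 1%R[) (beta_kernel a b t)%:E) /
   (\int[lebesgue_measure]_(t in `]0%R, 1%R[) (beta_kernel a b t)%:E))%E.

Definition stick (R : realType) (V : nat -> R) (i : nat) : R :=
  V i * \prod_(m < i) (1 - V m).

Definition decreasing_rearrangement (R : realType) (l w : nat -> R) : Prop :=
  (forall i, l i.+1 <= l i) /\
  exists2 s : nat -> nat, bijective s & forall i, l i = w (s i).

(* The rearrangement exists almost surely, on the event where all the sticks
   are positive and sum to 1. *)
Definition poisson_dirichlet (R : realType) (theta : R)
    (mu : set (seqspace R) -> \bar R) : Prop :=
  exists d (Omega : measurableType d) (P : probability Omega R)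
         (V : nat -> {RV P >-> R}) (l : {RV P >-> seqspace R}),
    [/\ mutually_independent P (fun i => V i : Omega -> R),
        forall i, same_law (distribution P (V i)) (beta_law 1 theta),
        {ae P, forall w,
           decreasing_rearrangement (l w) (stick (fun i => V i w))}
      & same_law mu (distribution P l)].

(* [Pi] is the law denoted by Pi_(theta, nu). Sequences indexed by i >= 1 are
   shifted to start at 0, so that [l w i] and [p w i] are l_(i+1) and p_(i+1).
   The sequence (0, l_1 p_1, l_2 p_2, ...) lies in the Kingman simplex only
   almost surely, whence the random element [X]. *)
Definition is_Pi (R : realType) (k : nat) (theta : R)
    (nu : probability (simplex R k) R)
    (Pi : probability (kingman R k) R) : Prop :=
  exists d (Omega : measurableType d) (P : probability Omega R)
         (l : {RV P >-> seqspace R}) (p : {RV P >-> seqspace (simplex R k)})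
         (X : {RV P >-> kingman R k}),
    [/\ poisson_dirichlet theta (distribution P l),
        mutually_independent P (fun i w => p w i)
          /\ (forall i, same_law (pushforward P (fun w => p w i)) nu),
        independent P l p,
        {ae P, forall w, kcoord (X w) 0 = 0 /\
           forall i j, kcoord (X w) i.+1 0 j = l w i * ucoord (p w i) j}
      & same_law Pi (distribution P X)].

(* Main.v *)
Require Import Defs.
From HB Require Import structures.
From mathcomp Require Import all_boot all_order all_algebra finmap.
From mathcomp Require Import all_classical all_reals all_analysis.
From mathcomp Require Import measurable_realfun ring lra.
Set Implicit Arguments.
Unset Strict Implicit.
Unset Printing Implicit Defensive.
Import Order.TTheory GRing.Theory Num.Theory.
Import numFieldNormedType.Exports.
Local Open Scope classical_set_scope.
Local Open Scope ring_scope.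

(** Moments of the colour masses. Under [Pi_(theta, nu)], the mass of colour [j]
    is [D_j = sum_i l_i u_j(p_i)], a randomly weighted sum of i.i.d. marks whose
    weights are independent of the marks and sum to 1. Its mean is therefore
    that of [u_j]. In the double series for [D_j ^ 2] the means of the marks
    multiply to [m ^ 2] off the diagonal and to [m ^ 2 + Var u_j] on it, whence
    [Var D_j = Var u_j * E (sum_i l_i ^ 2)] ([weighted_sum_moments]). The last
    factor is [1 / (theta + 1)] ([poisson_dirichlet_sum_sq]): a sum of squares
    does not see the rearrangement, so the Poisson-Dirichlet weights may be
    replaced by the sticks, and independence of the Beta(1, theta) variables
    [V_i] turns the second moments of the sticks into the geometric progression
    [E V ^ 2 * (E (1 - V) ^ 2) ^ i].

    Partial exchangeability, necessity. If the sampling formula is a mixture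
    with weights [p], partitions of one element identify [p_j] with the mean of
    [u_j]. The two partitions of two elements of colour [j] have probabilities
    [E u_j ^ 2 / (theta + 1)] and [theta (E u_j) ^ 2 / (theta + 1)], and the
    mixture bounds their sum by [p_j ^ 2 = (E u_j) ^ 2]. Hence every coordinate
    has zero variance, and [nu] is a Dirac measure ([dirac_of_exchangeable]).

    Partial exchangeability, sufficiency. If [nu] is the Dirac measure at [p],
    its moments are monomials in [p], so that the probability of a partition is
    [p] raised to its content times a factor free of [p]. This factor, suitably
    normalized, gives the components [colour_structure] of the mixture. All
    consistency relations reduce to one identity: the weights of the partitions
    obtained from [B] by inserting an element of colour [j], each multiplied by
    the number of ways to delete it again, add up to the weight of [B] times
    [theta + |B|] ([block_weight_insert_sum]), whatever [j] is. Consistency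
    implies that total masses do not depend on the size, so they all equal the
    mass 1 of the empty partition ([kernel_mass]). *)

(** * Insertion and deletion in chromatic partitions *)

Definition add_block (q : nat) (A : cpart q) (c : mindex q) : cpart q :=
  [fsfun A with c |-> (A c).+1].

Definition madd (q : nat) (b : mindex q) (j : 'I_q) : mindex q :=
  [ffun i => (b i + (i == j))%N].

Lemma add_blockE (q : nat) (A : cpart q) c a :
  add_block A c a = (A a + (a == c))%N.
Proof.
by rewrite fsfun_withE; case: eqP => [->|_]; rewrite ?addn1 ?addn0.
Qed.

Lemma big_finsupp_widen (q : nat) (M : Type) (idx : M)
    (op : Monoid.com_law idx) (phi : mindex q -> nat -> M)
    (A : cpart q) (D : {fset mindex q}) :
  (forall a, phi a 0%N = idx) -> (finsupp A `<=` D)%fset ->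
  \big[op/idx]_(a <- finsupp A) phi a (A a) =
  \big[op/idx]_(a <- D) phi a (A a).
Proof.
move=> phi0 AD; apply: big_fset_incl => // a _ aA.
by rewrite fsfun_dflt.
Qed.

(** Sums and products over the blocks change in a single term. The statement
    avoids division, so that it covers both [addn] on [nat] and multiplication
    by factors that may vanish. *)
Lemma big_add_block (q : nat) (M : Type) (idx : M)
    (op : Monoid.com_law idx) (phi : mindex q -> nat -> M)
    (A : cpart q) c : (forall a, phi a 0%N = idx) ->
  op (\big[op/idx]_(a <- finsupp (add_block A c)) phi a (add_block A c a))
     (phi c (A c)) =
  op (\big[op/idx]_(a <- finsupp A) phi a (A a)) (phi c (A c).+1).
Proof.
move=> phi0; have cD : c \in (c |` finsupp A)%fset by rewrite fset1U1.
rewrite (big_finsupp_widen op phi0 (fsubsetU1 c (finsupp A))).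
have AcD : (finsupp (add_block A c) `<=` c |` finsupp A)%fset.
  apply/fsubsetP => a; rewrite !inE !mem_finsupp add_blockE.
  by case: (a == c) => //=; rewrite addn0.
rewrite (big_finsupp_widen op phi0 AcD) !(big_fsetD1 c cD) /=.
rewrite add_blockE eqxx addn1 Monoid.mulmAC [RHS]Monoid.mulmAC.
congr (op _ _); first exact: Monoid.mulmC.
apply: eq_big_seq => a; rewrite !inE => /andP[/negPf ac _].
by rewrite add_blockE ac addn0.
Qed.

Definition remove_block (q : nat) (A : cpart q) (b : mindex q) : cpart q :=
  [fsfun A with b |-> (A b).-1].

(** The type [b] of the enlarged block ranges over the support of [B] and the
    origin, the latter standing for the creation of a new block. *)
Definition insert (q : nat) (B : cpart q) (b : mindex q) (j : 'I_q) : cpart q :=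
  add_block (if b == midx0 q then B else remove_block B b) (madd b j).

Definition content (q : nat) (A : cpart q) : mindex q :=
  [ffun j => (\sum_(a <- finsupp A) A a * a j)%N].

Lemma maddK (q : nat) (b : mindex q) j : mpred (madd b j) j = b.
Proof. by apply/ffunP => i; rewrite !ffunE addnK. Qed.

Lemma mpredK (q : nat) (a : mindex q) j : (0 < a j)%N -> madd (mpred a j) j = a.
Proof.
move=> aj; apply/ffunP => i; rewrite !ffunE subnK //.
by case: eqP => // ->.
Qed.

Lemma madd_gt0 (q : nat) (b : mindex q) j : (0 < madd b j j)%N.
Proof. by rewrite ffunE eqxx addn1. Qed.

Lemma madd_neq0 (q : nat) (b : mindex q) j : madd b j != midx0 q.
Proof.
by apply/eqP => /ffunP/(_ j); rewrite !ffunE eqxx addn1.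
Qed.

Lemma mpred_eq0 (q : nat) (a : mindex q) j : (0 < a j)%N ->
  (mpred a j == midx0 q) = (a == munit j).
Proof.
move=> aj; apply/eqP/eqP => [a0|->].
  by rewrite -(mpredK aj) a0; apply/ffunP => i; rewrite !ffunE.
by apply/ffunP => i; rewrite !ffunE subnn.
Qed.

Lemma deleteE (q : nat) (A : cpart q) (a : mindex q) j : (0 < a j)%N ->
  delete A a j = if mpred a j == midx0 q then remove_block A a
                 else add_block (remove_block A a) (mpred a j).
Proof. by move=> /mpred_eq0 ->. Qed.

Lemma add_blockK (q : nat) (A : cpart q) c : remove_block (add_block A c) c = A.
Proof.
apply/fsfunP => a; rewrite !fsfun_withE eqxx /=.
by case: eqP => [->|].
Qed.

Lemma remove_blockK (q : nat) (A : cpart q) c : c \in finsupp A ->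
  add_block (remove_block A c) c = A.
Proof.
rewrite mem_finsupp -lt0n => Ac; apply/fsfunP => a.
rewrite !fsfun_withE eqxx prednK //.
by case: eqP => [->|].
Qed.

Lemma deleteK (q : nat) (A : cpart q) (a : mindex q) j : a \in finsupp A -> (0 < a j)%N ->
  insert (delete A a j) (mpred a j) j = A.
Proof.
move=> aA aj; rewrite /insert deleteE // mpredK //.
by case: (mpred a j == _); rewrite ?add_blockK remove_blockK.
Qed.

Lemma insertK (q : nat) (B : cpart q) (b : mindex q) j :
  b \in (midx0 q |` finsupp B)%fset ->
  delete (insert B b j) (madd b j) j = B.
Proof.
rewrite in_fset1U deleteE ?madd_gt0 // maddK /insert add_blockK.
by case: (b == _) => //= bB; rewrite remove_blockK.
Qed.

Lemma mpred_mem (q : nat) (A : cpart q) (a : mindex q) j : (0 < a j)%N ->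
  mpred a j \in (midx0 q |` finsupp (delete A a j))%fset.
Proof.
move=> aj; rewrite in_fset1U deleteE //; case: ifP => //= _.
by rewrite mem_finsupp add_blockE eqxx addn1.
Qed.

Lemma madd_mem (q : nat) (B : cpart q) (b : mindex q) j :
  madd b j \in finsupp (insert B b j).
Proof. by rewrite mem_finsupp add_blockE eqxx addn1. Qed.

(** Deletion and insertion are mutually inverse ([deleteK], [insertK]), so
    summing over the deletions of [A] that lead to [B] is summing over the
    insertions in [B] that lead to [A]. *)
Lemma sum_delete_insert (q : nat) (V : nmodType) (G : mindex q -> V)
    (A B : cpart q) j :
  \sum_(a <- finsupp A | (0 < a j)%N && (B == delete A a j)) G a =
  \sum_(b <- (midx0 q |` finsupp B)%fset | A == insert B b j) G (madd b j).
Proof.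
rewrite -big_filter -[RHS]big_filter -(big_map (fun b => madd b j) predT G).
apply: perm_big; apply: uniq_perm.
- by rewrite filter_uniq // fset_uniq.
- rewrite map_inj_uniq ?filter_uniq ?fset_uniq // => b b' bb'.
  by rewrite -(maddK b j) bb' maddK.
move=> a; rewrite mem_filter; apply/idP/mapP.
- move=> /andP[/andP[aj /eqP->] aA]; exists (mpred a j); last by rewrite mpredK.
  by rewrite mem_filter mpred_mem // deleteK // eqxx.
- move=> [b]; rewrite mem_filter => /andP[/eqP -> bB] ->.
  by rewrite madd_gt0 insertK // eqxx madd_mem.
Qed.

Lemma content_add_block (q : nat) (A : cpart q) c j :
  content (add_block A c) j = (content A j + c j)%N.
Proof.
have /= := @big_add_block q nat 0%N addn (fun a n => n * a j)%N A c _.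
rewrite !ffunE => /(_ (fun=> mul0n _))/eqP.
by rewrite mulSn addnA eqn_add2r => /eqP.
Qed.

Lemma content_insert (q : nat) (B : cpart q) b j :
  b \in (midx0 q |` finsupp B)%fset ->
  content (insert B b j) = madd (content B) j.
Proof.
rewrite in_fset1U => bB; apply/ffunP => i.
rewrite content_add_block [in RHS]ffunE [madd b j i]ffunE addnA; congr addn.
case: ifP bB => [/eqP -> _|_ /= bB]; first by rewrite [midx0 q i]ffunE addn0.
by rewrite -content_add_block remove_blockK.
Qed.

Lemma insert0 (q : nat) (B : cpart q) b j :
  insert B b j (midx0 q) = B (midx0 q).
Proof.
rewrite add_blockE [midx0 q == _]eq_sym (negPf (madd_neq0 _ _)) addn0.
case: ifP => // b0; rewrite fsfun_withE ifF //.
by rewrite eq_sym.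
Qed.

Lemma content_delete (q : nat) (A : cpart q) a j :
  a \in finsupp A -> (0 < a j)%N -> content (delete A a j) = mpred (content A) j.
Proof.
move=> aA aj; rewrite -[in RHS](deleteK aA aj) content_insert ?maddK //.
exact: mpred_mem.
Qed.

Lemma delete0 (q : nat) (A : cpart q) a j :
  a \in finsupp A -> (0 < a j)%N -> delete A a j (midx0 q) = A (midx0 q).
Proof. by move=> aA aj; rewrite -[in RHS](deleteK aA aj) insert0. Qed.

Lemma mnorm_eq0 (q : nat) (a : mindex q) : (mnorm a == 0%N) = (a == midx0 q).
Proof.
rewrite /mnorm sum_nat_eq0; apply/forallP/eqP => [a0|-> j]; last by rewrite ffunE.
by apply/ffunP => j; rewrite ffunE; apply/eqP/(implyP (a0 j)).
Qed.

Lemma mnorm_madd (q : nat) (b : mindex q) j : mnorm (madd b j) = (mnorm b).+1.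
Proof.
rewrite /mnorm; under eq_bigr do rewrite ffunE.
rewrite big_split /= -addn1; congr addn.
rewrite (bigD1 j) //= eqxx big1 // => i /negPf.
by case: (i == j).
Qed.

Lemma mnorm_content (q : nat) (A : cpart q) :
  mnorm (content A) = (\sum_(a <- finsupp A) A a * mnorm a)%N.
Proof.
rewrite /mnorm; under eq_bigr do rewrite ffunE.
by rewrite exchange_big; apply: eq_bigr => a _; rewrite big_distrr.
Qed.

Lemma partsE (q n : nat) (A : cpart q) :
  parts n A <-> A (midx0 q) = 0%N /\ mnorm (content A) = n.
Proof. by rewrite mnorm_content. Qed.

Lemma parts_colorE (q : nat) (n : mindex q) (A : cpart q) :
  parts_color n A <-> A (midx0 q) = 0%N /\ content A = n.
Proof.
split=> -[A0 An]; split=> //; first by apply/ffunP => j; rewrite ffunE.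
by move=> j; rewrite -An ffunE.
Qed.

Lemma exists_deletion (q : nat) (A : cpart q) j : (0 < content A j)%N ->
  exists2 a, a \in finsupp A & (0 < a j)%N.
Proof.
rewrite ffunE lt0n => An0; apply/not_exists2P => An; move: An0.
rewrite big1_seq //= => a aA.
by have [//|/negP] := An a; rewrite lt0n negbK => /eqP ->; rewrite muln0.
Qed.

Lemma parts0E (q : nat) : @parts q 0 = [set [fsfun] : cpart q].
Proof.
apply/seteqP; split=> A; last by move=> ->; split; rewrite ?fsfun0E ?finsupp0 ?big_nil.
move=> /partsE[A0 /eqP An]; apply/fsfunP => a; rewrite fsfun0E.
apply/eqP/negPn/negP; rewrite -mem_finsupp => aA.
have [a0|a0] := eqVneq a (midx0 q).
  by move: aA; rewrite mem_finsupp a0 A0.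
move: a0; rewrite -mnorm_eq0 /mnorm sum_nat_eq0 => /forallPn[j].
rewrite /= -lt0n => aj.
move: An; rewrite mnorm_eq0 => /eqP/ffunP/(_ j)/eqP; rewrite !ffunE.
rewrite (big_fsetD1 a aA) /= addn_eq0 muln_eq0 => /andP[/orP[]].
  by rewrite mem_finsupp in aA; rewrite (negPf aA).
by rewrite eqn0Ngt aj.
Qed.

(** Every partition of [n + 1] elements arises by inserting an element in a
    partition of [n] elements. *)
Lemma finite_parts (q n : nat) : finite_set (@parts q n).
Proof.
elim: n => [|n IHn]; first by rewrite parts0E; exact: finite_set1.
pose S := \bigcup_(B in @parts q n) \bigcup_(j in [set: 'I_q])
  [set insert B b j | b in [set` (midx0 q |` finsupp B)%fset]].
apply: (@sub_finite_set _ _ S); last first.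
  apply: bigcup_finite => // B _; apply: bigcup_finite => // j _.
  by apply: finite_image; exact: finite_fset.
move=> A /partsE[A0 An].
have : mnorm (content A) != 0%N by rewrite An.
rewrite /mnorm sum_nat_eq0 => /forallPn[j]; rewrite /= -lt0n => Aj.
have [a aA aj] := exists_deletion Aj.
exists (delete A a j).
  apply/partsE; split; first by rewrite delete0.
  by apply/eqP; rewrite -eqSS -An -(mpredK Aj) mnorm_madd content_delete.
exists j => //; exists (mpred a j); last by rewrite deleteK.
exact: mpred_mem.
Qed.

Lemma sub_parts_color (q : nat) (n : mindex q) :
  parts_color n `<=` @parts q (mnorm n).
Proof. by move=> A /parts_colorE[A0 An]; apply/partsE; rewrite An. Qed.

Lemma finite_parts_color (q : nat) (n : mindex q) : finite_set (parts_color n).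
Proof. exact: sub_finite_set (@sub_parts_color q n) (finite_parts q (mnorm n)). Qed.

Lemma parts_color_delete (q : nat) (n : mindex q) j (A : cpart q) a :
  parts_color n A -> a \in finsupp A -> (0 < a j)%N ->
  parts_color (mpred n j) (delete A a j).
Proof.
move=> /parts_colorE[A0 <-] aA aj; apply/parts_colorE.
by rewrite delete0 // content_delete.
Qed.

Lemma parts_color_insert (q : nat) (n : mindex q) j (B : cpart q) b :
  parts_color n B -> b \in (midx0 q |` finsupp B)%fset ->
  parts_color (madd n j) (insert B b j).
Proof.
by move=> /parts_colorE[B0 <-] bB; apply/parts_colorE; rewrite insert0 content_insert.
Qed.

(** * Weights of partitions *)

Definition block_weight (R : realType) (q : nat) (w : mindex q -> R)
    (A : cpart q) : R :=
  \prod_(a <- finsupp A) (((A a)`!)%:R^-1 * w a ^+ A a).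

(** The value of [theta / |a| * multinomial a] away from the origin, that is,
    the weight of a block in the sampling formula without its moment. *)
Definition colour_weight (R : realType) (q : nat) (theta : R) (a : mindex q) : R :=
  theta * ((mnorm a).-1`!)%:R / (\prod_j (a j)`!)%:R.

Lemma block_weight_add (R : realType) (q : nat) (w : mindex q -> R)
    (A : cpart q) (c : mindex q) : w c != 0 ->
  block_weight w (add_block A c) * (A c).+1%:R = block_weight w A * w c.
Proof.
move=> wc0; pose phi (a : mindex q) n : R := n`!%:R^-1 * w a ^+ n.
have phi0 a : phi a 0%N = 1 by rewrite /phi fact0 invr1 mulr1.
have /= := big_add_block *%R A c phi0.
rewrite -![\prod_(a <- _) _]/(block_weight w _) => E.
have f0 n : n`!%:R != 0 :> R by rewrite pnatr_eq0 -lt0n fact_gt0.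
have nz : phi c (A c) != 0 by rewrite mulf_neq0 ?invr_eq0 ?expf_neq0.
apply: (mulIf nz); rewrite mulrAC E -!mulrA; congr (_ * _).
rewrite /phi; move: (A c) (w c) => n x; rewrite factS natrM exprS invfM.
have : n.+1%:R != 0 :> R by rewrite pnatr_eq0.
move: (n.+1%:R) (n`!%:R) (x ^+ n) (f0 n) => s f y f1 s1.
by field; rewrite s1 f1.
Qed.

Lemma prod_fact_madd (q : nat) (b : mindex q) j :
  (\prod_i (madd b j i)`! = (b j).+1 * \prod_i (b i)`!)%N.
Proof.
rewrite (bigD1 j) //= [in RHS](bigD1 j) //= !ffunE eqxx addn1 factS mulnA.
by congr muln; apply: eq_bigr => i /negPf ij; rewrite ffunE ij addn0.
Qed.

Lemma prod_fact_neq0 (R : realType) (q : nat) (b : mindex q) :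
  (\prod_i (b i)`!)%:R != 0 :> R.
Proof.
by rewrite pnatr_eq0 -lt0n; apply: prodn_gt0 => i; exact: fact_gt0.
Qed.

Lemma colour_weight_gt0 (R : realType) (q : nat) (theta : R) (a : mindex q) :
  0 < theta -> 0 < colour_weight theta a.
Proof.
move=> t0; rewrite /colour_weight !mulr_gt0 ?ltr0n ?fact_gt0 //.
by rewrite invr_gt0 lt0r prod_fact_neq0 ler0n.
Qed.

Lemma colour_weight_munit (R : realType) (q : nat) (theta : R) j :
  colour_weight theta (madd (midx0 q) j) = theta.
Proof.
rewrite /colour_weight mnorm_madd prod_fact_madd.
have -> : mnorm (midx0 q) = 0%N by apply/eqP; rewrite mnorm_eq0.
rewrite ffunE mul1n big1 ?divr1 ?mulr1 // => i _; by rewrite ffunE.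
Qed.

Lemma colour_weight_madd (R : realType) (q : nat) (theta : R)
    (b : mindex q) j : b != midx0 q ->
  colour_weight theta (madd b j) * (madd b j j)%:R =
  (mnorm b)%:R * colour_weight theta b.
Proof.
rewrite -mnorm_eq0 => b0; rewrite /colour_weight mnorm_madd prod_fact_madd /=.
rewrite [madd b j j]ffunE eqxx addn1.
case: (mnorm b) b0 => // n _; rewrite factS !natrM /=.
field; rewrite prod_fact_neq0 /=; by rewrite nat1r pnatr_eq0.
Qed.

(** This is the Chinese restaurant scheme: [(b_j + 1) w(b + e_j) = |b| w(b)],
    so that a block attracts a new element proportionally to its size,
    independently of the colours. *)
Lemma block_weight_insert (R : realType) (q : nat) (theta : R)
    (B : cpart q) (b : mindex q) j : 0 < theta ->
  b \in (midx0 q |` finsupp B)%fset ->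
  block_weight (colour_weight theta) (insert B b j) *
    (madd b j j * insert B b j (madd b j))%:R =
  block_weight (colour_weight theta) B *
    (if b == midx0 q then theta else (B b * mnorm b)%:R).
Proof.
move=> t0; set w := colour_weight theta.
have w0 a : w a != 0 by rewrite gt_eqF // colour_weight_gt0.
rewrite in_fset1U /insert add_blockE eqxx addn1 mulnC natrM mulrA.
case: eqVneq => [-> _|b0 /= bB].
  rewrite block_weight_add // /w colour_weight_munit.
  by rewrite !ffunE eqxx mulr1.
rewrite block_weight_add // -mulrA colour_weight_madd //.
have Bb : B b = (remove_block B b b).+1.
  by rewrite -[in LHS](remove_blockK bB) add_blockE eqxx addn1.
have := block_weight_add (remove_block B b) (w0 b).
rewrite remove_blockK // => E.
by rewrite Bb natrM [RHS]mulrA E -mulrA [_ * w b]mulrC.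
Qed.

Lemma sum_deletion_insert (R : realType) (q : nat) (S : set (cpart q))
    (G : cpart q -> R) (B : cpart q) j : finite_set S ->
  (forall b, b \in (midx0 q |` finsupp B)%fset -> S (insert B b j)) ->
  \sum_(A \in S) G A *
    (\sum_(a <- finsupp A | (0 < a j)%N && (B == delete A a j)) (a j * A a)%:R) =
  \sum_(b <- (midx0 q |` finsupp B)%fset)
    G (insert B b j) * (madd b j j * insert B b j (madd b j))%:R.
Proof.
move=> Sfin SB; rewrite fsbig_finite //=.
under eq_bigr => A _ do
  rewrite (sum_delete_insert (fun a : mindex q => (a j * A a)%:R)) mulr_sumr big_mkcond.
rewrite exchange_big; apply: eq_big_seq => b bB.
have bS : insert B b j \in fset_set S by rewrite in_fset_set // inE; exact: SB.
rewrite (big_fsetD1 _ bS) /= eqxx big1_seq ?addr0 // => A.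
by rewrite in_fsetD1 => /andP[_ /andP[/negPf ->]].
Qed.

Lemma block_weight_insert_sum (R : realType) (q : nat) (theta : R)
    (B : cpart q) j : 0 < theta -> B (midx0 q) = 0%N ->
  \sum_(b <- (midx0 q |` finsupp B)%fset)
    block_weight (colour_weight theta) (insert B b j) *
    (madd b j j * insert B b j (madd b j))%:R =
  block_weight (colour_weight theta) B * (theta + (mnorm (content B))%:R).
Proof.
move=> t0 B0.
under eq_big_seq => b bB do rewrite block_weight_insert //.
rewrite -mulr_sumr big_fsetU1 ?mem_finsupp ?B0 //= eqxx; congr (_ * (_ + _)).
rewrite mnorm_content natr_sum; apply: eq_big_seq => b bB.
case: eqP => // b0; by move: bB; rewrite mem_finsupp b0 B0.
Qed.

Lemma sum_deletions (R : realType) (q : nat) (S : set (cpart q))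
    (A : cpart q) j (c : mindex q -> R) : finite_set S ->
  (forall a, a \in finsupp A -> (0 < a j)%N -> S (delete A a j)) ->
  \sum_(B \in S)
    (\sum_(a <- finsupp A | (0 < a j)%N && (B == delete A a j)) c a) =
  \sum_(a <- finsupp A | (0 < a j)%N) c a.
Proof.
move=> Sfin SA; rewrite fsbig_finite //=.
under eq_bigr do rewrite big_mkcondr.
rewrite exchange_big /=.
rewrite [LHS]big_seq_cond [RHS]big_seq_cond; apply: eq_bigr => a /andP[aA aj].
have aS : delete A a j \in fset_set S by rewrite in_fset_set // inE; exact: SA.
rewrite (big_fsetD1 _ aS) /= eqxx big1_seq ?addr0 // => B.
by rewrite in_fsetD1 => /andP[_ /andP[/negPf ->]].
Qed.

Lemma sum_content (R : realType) (q : nat) (A : cpart q) j :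
  \sum_(a <- finsupp A | (0 < a j)%N) (a j * A a)%:R = (content A j)%:R :> R.
Proof.
rewrite ffunE natr_sum big_mkcond; apply: eq_bigr => a _.
by rewrite mulnC lt0n; case: eqP => //= ->; rewrite muln0.
Qed.

(** Used with deletion kernels, this yields the normalization of laws on
    partitions from their consistency, by induction on the size. *)
Lemma kernel_mass (R : realType) (T : choiceType) (S S' : set T)
    (F G : T -> R) (K : T -> T -> R) : finite_set S -> finite_set S' ->
  (forall A, S' A -> \sum_(B \in S) K A B = 1) ->
  (forall B, S B -> G B = \sum_(A \in S') F A * K A B) ->
  \sum_(B \in S) G B = \sum_(A \in S') F A.
Proof.
move=> fS fS' K1 GE.
transitivity (\sum_(B \in S) \sum_(A \in S') F A * K A B).
  by apply: eq_fsbigr => B /set_mem SB; exact: GE.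
rewrite exchange_fsbig //; apply: eq_fsbigr => A /set_mem SA.
by rewrite -mulr_fsumr ?K1 ?mulr1.
Qed.

Lemma risingS (R : realType) (theta : R) n :
  rising theta n.+1 = rising theta n * (theta + n%:R).
Proof. by rewrite /rising big_ord_recr. Qed.

Lemma rising_gt0 (R : realType) (theta : R) n : 0 < theta -> 0 < rising theta n.
Proof. by move=> t0; apply: prodr_gt0 => i _; rewrite ltr_pwDl. Qed.

(** The law of the block types of an Ewens partition of [|n|] elements, [n j] of
    which carry the colour [j]. Given the number of elements of each colour,
    i.i.d. colours form a uniform colouring, whatever [p] is. *)
Definition colour_structure (R : realType) (q : nat) (theta : R)
    (n : mindex q) (A : cpart q) : R :=
  if A \in parts_color n then
    (\prod_j (n j)`!)%:R / rising theta (mnorm n) *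
    block_weight (colour_weight theta) A
  else 0.

Lemma block_weight_gt0 (R : realType) (q : nat) (theta : R) (A : cpart q) :
  0 < theta -> 0 < block_weight (colour_weight theta) A.
Proof.
move=> t0; apply: prodr_gt0 => a _; apply: mulr_gt0.
  by rewrite invr_gt0 ltr0n fact_gt0.
exact/exprn_gt0/colour_weight_gt0.
Qed.

Lemma color_deletionE (R : realType) (q : nat) (n : mindex q) j (A B : cpart q) :
  color_deletion R n j A B =
  (\sum_(a <- finsupp A | (0 < a j)%N && (B == delete A a j)) (a j * A a)%:R) /
    (n j)%:R.
Proof. by rewrite mulr_suml. Qed.

Lemma color_deletion_mass (R : realType) (q : nat) (n : mindex q) j
    (A : cpart q) : (0 < n j)%N -> parts_color n A ->
  \sum_(B \in parts_color (mpred n j)) color_deletion R n j A B = 1.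
Proof.
move=> nj nA; have /parts_colorE[_ An] := nA.
under eq_fsbigr do rewrite color_deletionE.
rewrite -mulr_fsuml sum_deletions; last 2 first.
- exact: finite_parts_color.
- by move=> a; exact: parts_color_delete.
by rewrite sum_content An divff // pnatr_eq0 -lt0n.
Qed.

Lemma colour_structure_deletion (R : realType) (q : nat) (theta : R)
    (m : mindex q) j (B : cpart q) : 0 < theta -> parts_color m B ->
  colour_structure theta m B =
  \sum_(A \in parts_color (madd m j))
    colour_structure theta (madd m j) A * color_deletion R (madd m j) j A B.
Proof.
move=> t0 mB; have /parts_colorE[B0 Bm] := mB.
under eq_fsbigr do rewrite color_deletionE mulrA.
rewrite -mulr_fsuml sum_deletion_insert; last 2 first.
- exact: finite_parts_color.
- by move=> b; exact: parts_color_insert.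
rewrite /colour_structure mem_set //.
pose K : R := (\prod_i (madd m j i)`!)%:R / rising theta (mnorm (madd m j)).
rewrite [in RHS](eq_big_seq (fun b =>
    K * (block_weight (colour_weight theta) (insert B b j) *
         (madd b j j * insert B b j (madd b j))%:R))); last first.
  by move=> b bB; rewrite mem_set ?mulrA //; exact: parts_color_insert.
rewrite {}/K.
rewrite -mulr_sumr block_weight_insert_sum // Bm mnorm_madd risingS.
rewrite prod_fact_madd natrM [madd m j j]ffunE eqxx addn1.
have r0 : rising theta (mnorm m) != 0 by rewrite gt_eqF ?rising_gt0.
have tm : theta + (mnorm m)%:R != 0 by rewrite gt_eqF // ltr_pwDl.
have mj : (m j).+1%:R != 0 :> R by rewrite pnatr_eq0.
move: (m j).+1%:R mj (theta + _) tm => s s0 t tn0.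
by field; rewrite r0 s0 tn0.
Qed.

Lemma mnorm0 (q : nat) : mnorm (midx0 q) = 0%N.
Proof. by apply/eqP; rewrite mnorm_eq0. Qed.

Lemma parts_color0E (q : nat) : parts_color (midx0 q) = [set [fsfun] : cpart q].
Proof.
apply/seteqP; split=> A.
  by move=> /sub_parts_color; rewrite mnorm0 parts0E.
move=> ->; apply/parts_colorE; rewrite fsfun0E; split => //.
by apply/ffunP => j; rewrite !ffunE finsupp0 big_nil.
Qed.

Lemma colour_structureP (R : realType) (q : nat) (theta : R) : 0 < theta ->
  partially_exchangeable_structure (@colour_structure R q theta).
Proof.
move=> t0; split; last first.
  move=> n j nj B mB; rewrite (colour_structure_deletion j) //.
  by rewrite mpredK.
move=> n; split=> [A|A nA|].
- rewrite /colour_structure; case: ifP => // _.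
  by rewrite mulr_ge0 ?divr_ge0 ?ler0n ?ltW ?rising_gt0 ?block_weight_gt0.
- by rewrite /colour_structure memNset.
move: {2}(mnorm n) (erefl (mnorm n)) => N.
elim: N n => [|N IHN] n nN.
  move/eqP: nN; rewrite mnorm_eq0 => /eqP ->; rewrite parts_color0E fsbig_set1.
  rewrite /colour_structure mem_set; last by rewrite parts_color0E.
  rewrite mnorm0 /rising big_ord0 big1 ?divr1 => [|j _]; last by rewrite ffunE.
  by rewrite mul1r /block_weight finsupp0 big_nil.
have : mnorm n != 0%N by rewrite nN.
rewrite /mnorm sum_nat_eq0 => /forallPn[j]; rewrite /= -lt0n => nj.
have mN : mnorm (mpred n j) = N.
  by apply: succn_inj; rewrite -nN -[in RHS](mpredK nj) mnorm_madd.
rewrite -(IHN _ mN); apply/esym; apply: (kernel_mass (K := color_deletion R n j)).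
- exact: finite_parts_color.
- exact: finite_parts_color.
- by move=> A nA; exact: color_deletion_mass.
move=> B mB; rewrite (colour_structure_deletion j) //.
by rewrite mpredK.
Qed.

(** * The sampling formula of a Dirac measure *)

Lemma monomial_madd (R : realType) (q : nat) (p : 'I_q -> R) (m : mindex q) j :
  \prod_i p i ^+ madd m j i = p j * \prod_i p i ^+ m i.
Proof.
under eq_bigr do rewrite ffunE exprD.
rewrite big_split /= mulrC; congr (_ * _).
rewrite (bigD1 j) //= eqxx expr1 big1 ?mulr1 // => i /negPf ->.
by rewrite expr0.
Qed.

Lemma ucoord_ge0 (R : realType) (k : nat) (u : simplex R k) j : 0 <= ucoord u j.
Proof. by have [/(_ j)/andP[]] := set_mem (valP (u : simplex_pts R k)). Qed.

Lemma ucoord_le1 (R : realType) (k : nat) (u : simplex R k) j : ucoord u j <= 1.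
Proof. by have [/(_ j)/andP[]] := set_mem (valP (u : simplex_pts R k)). Qed.

Lemma sum_ucoord (R : realType) (k : nat) (u : simplex R k) :
  \sum_j ucoord u j = 1.
Proof.
have [_ <-] := set_mem (valP (u : simplex_pts R k)).
by apply: eq_bigr => j _; rewrite ger0_norm //; exact: ucoord_ge0.
Qed.

Lemma colour_weightE (R : realType) (q : nat) (theta : R) (a : mindex q) :
  a != midx0 q -> theta / (mnorm a)%:R * multinomial R a = colour_weight theta a.
Proof.
rewrite -mnorm_eq0 /multinomial /colour_weight; case: (mnorm a) => // n _.
rewrite factS natrM /=.
have n0 : n.+1%:R != 0 :> R by rewrite pnatr_eq0.
have := prod_fact_neq0 R a.
by move: (n.+1%:R) n0 (_%:R) => s s0 t t0; field; rewrite s0 t0.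
Qed.

Lemma block_weight_monomial (R : realType) (q : nat) (w : mindex q -> R)
    (p : 'I_q -> R) (A : cpart q) :
  block_weight (fun a => w a * \prod_j p j ^+ a j) A =
  block_weight w A * \prod_j p j ^+ content A j.
Proof.
rewrite /block_weight; under eq_bigr do rewrite exprMn mulrA.
rewrite big_split /=; congr (_ * _).
under eq_bigr do rewrite -prodrXl.
rewrite exchange_big; apply: eq_bigr => j _.
rewrite /content ffunE expr_sum; apply: eq_bigr => a _.
by rewrite -exprM mulnC.
Qed.

Lemma pESF_monomial (R : realType) (k : nat) (theta : R)
    (nu : probability (simplex R k) R) (p : 'I_k.+1 -> R) n (A : cpart k.+1) :
  (forall a, moment nu a = \prod_j p j ^+ a j) -> parts n A ->
  pESF theta nu n A =
  (n`!)%:R / rising theta n *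
  (block_weight (colour_weight theta) A * \prod_j p j ^+ content A j).
Proof.
move=> mp nA; rewrite /pESF mem_set // -block_weight_monomial; congr (_ * _).
apply: eq_big_seq => a aA; rewrite mp colour_weightE //.
apply: contraTneq aA => ->; rewrite mem_finsupp negbK.
by case: nA => ->.
Qed.

Lemma parts_delete (q n : nat) (A : cpart q) a j :
  parts n.+1 A -> a \in finsupp A -> (0 < a j)%N -> parts n (delete A a j).
Proof.
move=> /partsE[A0 An] aA aj; apply/partsE; rewrite delete0 // content_delete //.
split=> //; apply: succn_inj; rewrite -An -[in RHS](mpredK (a := content A) (j := j)).
  by rewrite mnorm_madd.
rewrite ffunE (big_fsetD1 a aA) /= addn_gt0 muln_gt0 aj andbT lt0n.
by rewrite -mem_finsupp aA.
Qed.

Lemma parts_insert (q n : nat) (B : cpart q) b j :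
  parts n B -> b \in (midx0 q |` finsupp B)%fset -> parts n.+1 (insert B b j).
Proof.
move=> /partsE[B0 Bn] bB; apply/partsE.
by rewrite insert0 content_insert // mnorm_madd Bn.
Qed.

Lemma uniform_deletionE (R : realType) (q n : nat) (A B : cpart q) :
  uniform_deletion R n A B =
  (\sum_(j < q) \sum_(a <- finsupp A | (0 < a j)%N && (B == delete A a j))
     (a j * A a)%:R) / n%:R.
Proof.
by rewrite /uniform_deletion mulr_suml; under [RHS]eq_bigr do rewrite mulr_suml.
Qed.

Lemma uniform_deletion_mass (R : realType) (q n : nat) (A : cpart q) :
  parts n.+1 A -> \sum_(B \in @parts q n) uniform_deletion R n.+1 A B = 1.
Proof.
move=> nA; under eq_fsbigr do rewrite uniform_deletionE.
rewrite -mulr_fsuml fsbig_finite; last exact: finite_parts.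
rewrite exchange_big /=.
under eq_bigr => j _.
  rewrite -fsbig_finite; last exact: finite_parts.
  rewrite sum_deletions; last 2 first.
  - exact: finite_parts.
  - by move=> a; exact: parts_delete.
  rewrite sum_content; over.
rewrite -natr_sum -[(\sum_(i < q) _)%N]/(mnorm (content A)).
by have /partsE[_ ->] := nA; rewrite divff // pnatr_eq0.
Qed.

(** Inserting an element of colour [j] multiplies the monomial in [p] by
    [p_j]; the colours are summed out with [sum_j p_j = 1]. *)
Lemma pESF_uniform_deletion (R : realType) (k : nat) (theta : R)
    (nu : probability (simplex R k) R) (p : 'I_k.+1 -> R) n (B : cpart k.+1) :
  0 < theta -> \sum_j p j = 1 ->
  (forall a, moment nu a = \prod_j p j ^+ a j) -> parts n B ->
  pESF theta nu n B =
  \sum_(A \in @parts k.+1 n.+1)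
    pESF theta nu n.+1 A * uniform_deletion R n.+1 A B.
Proof.
move=> t0 p1 mp nB; have /partsE[B0 Bn] := nB.
under eq_fsbigr do rewrite uniform_deletionE mulrA.
rewrite -mulr_fsuml fsbig_finite; last exact: finite_parts.
under eq_bigr do rewrite mulr_sumr.
rewrite exchange_big /=.
pose K : R := (n.+1`!)%:R / rising theta n.+1 *
  (block_weight (colour_weight theta) B * (theta + n%:R)) *
  (\prod_i p i ^+ content B i).
under eq_bigr => j _.
  rewrite -fsbig_finite; last exact: finite_parts.
  rewrite sum_deletion_insert; last 2 first.
  - exact: finite_parts.
  - by move=> b; exact: parts_insert.
  rewrite (_ : \sum_(_ <- _) _ = K * p j); last first.
    pose L : R := (n.+1`!)%:R / rising theta n.+1 *
                  (p j * \prod_i p i ^+ content B i).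
    rewrite (eq_big_seq (fun b =>
      L * (block_weight (colour_weight theta) (insert B b j) *
         (madd b j j * insert B b j (madd b j))%:R))); last first.
      move=> b bB; rewrite (pESF_monomial _ mp); last exact: parts_insert.
      by rewrite content_insert // monomial_madd /L; ring.
    rewrite -mulr_sumr block_weight_insert_sum // Bn /K /L; ring.
  over.
rewrite -mulr_sumr p1 mulr1 (pESF_monomial _ mp) // /K risingS factS natrM.
have r0 : rising theta n != 0 by rewrite gt_eqF ?rising_gt0.
have tm : theta + n%:R != 0 by rewrite gt_eqF // ltr_pwDl.
have n0 : n.+1%:R != 0 :> R by rewrite pnatr_eq0.
move: (n.+1%:R) n0 (theta + _) tm => s s0 t tn0.
by field; rewrite r0 s0 tn0.
Qed.

Lemma measurable_ucoord (R : realType) (k : nat) (j : 'I_k.+1) :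
  measurable_fun [set: simplex R k] (fun u => ucoord u j).
Proof.
apply: (measurability _ (RGenOpens.measurableE R)) => _ [_ [x [y ->]] <-].
rewrite setTI; apply: sub_sigma_algebra.
exists [set v : 'rV[R]_k.+1 | v 0 j \in `]x, y[]; last by [].
apply: (@open_comp _ _ (fun v : 'rV[R]_k.+1 => v 0 j) `]x, y[%classic).
  by move=> v _; exact: coord_continuous.
exact: interval_open.
Qed.

Lemma moment_dirac (R : realType) (k : nat) (nu : probability (simplex R k) R)
    (p : simplex R k) (a : mindex k.+1) : same_law nu (\d_p) ->
  moment nu a = \prod_j ucoord p j ^+ a j.
Proof.
move=> nup; rewrite /moment /Rintegral.
rewrite (eq_measure_integral (\d_p)); last by move=> A mA _; exact: nup.
rewrite integral_dirac //.
  by rewrite diracT mul1e.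
apply/measurable_EFinP; apply: measurable_prod => j _.
by apply: measurable_funX; exact: measurable_ucoord.
Qed.

Lemma pESF_dirac (R : realType) (k : nat) (theta : R)
    (nu : probability (simplex R k) R) (p : simplex R k) : 0 < theta ->
  same_law nu (\d_p) -> partially_exchangeable_type (pESF theta nu).
Proof.
move=> t0 nup; have mp a := moment_dirac a nup.
have P0 n A : ~ parts n A -> pESF theta nu n A = 0.
  by move=> nA; rewrite /pESF memNset.
have Pm := @pESF_uniform_deletion R k theta nu _ _ _ t0 (sum_ucoord p) mp.
split; last first.
  exists p, (@colour_structure R k.+1 theta); split; first exact: colour_structureP.
  move=> n A; have [nA|nA] := pselect (parts n A); last first.
    rewrite P0 // fsbig1 // => m /= mn.
    rewrite /colour_structure memNset ?mulr0 // => mA.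
    by apply: nA; rewrite -mn; exact: sub_parts_color.
  have /partsE[A0 An] := nA.
  rewrite (fsbigE [:: content A]) //=; last 2 first.
  - by move=> m /=; rewrite mem_seq1 => /eqP ->.
  - move=> m mn; rewrite mem_seq1 => /eqP mA.
    rewrite /colour_structure memNset ?mulr0 // => /parts_colorE[_ Am].
    by apply: mA; rewrite Am.
  rewrite big_cons big_nil /= mem_set //= addr0.
  rewrite /colour_structure mem_set; last exact/parts_colorE.
  rewrite (pESF_monomial _ mp) // /multinomial An.
  have := prod_fact_neq0 R (content A).
  have := gt_eqF (rising_gt0 n t0).
  move: (\prod_j _)%:R (rising theta n) => x y y0 x0.
  by field; rewrite y0 x0.
split=> // n; split=> [A||].
- have [nA|nA] := pselect (parts n A); last by rewrite P0.
  rewrite (pESF_monomial _ mp) // mulr_ge0 //.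
    by rewrite divr_ge0 // ltW // rising_gt0.
  rewrite mulr_ge0 //; first exact/ltW/block_weight_gt0.
  by apply: prodr_ge0 => j _; apply: exprn_ge0; exact: ucoord_ge0.
- by move=> A; exact: P0.
elim: n => [|n IHn].
  rewrite parts0E fsbig_set1 (pESF_monomial _ mp); last by rewrite parts0E.
  rewrite /rising big_ord0 fact0 divr1 mul1r /block_weight finsupp0 big_nil mul1r.
  by rewrite big1 // => j _; rewrite ffunE finsupp0 big_nil expr0.
rewrite -IHn; apply/esym.
apply: (kernel_mass (K := uniform_deletion R n.+1)).
- exact: finite_parts.
- exact: finite_parts.
- by move=> A nA; exact: uniform_deletion_mass.
- by move=> B nB; exact: Pm.
Qed.

(** * Partial exchangeability forces a Dirac measure *)

Lemma integrable_bounded01 d (T : measurableType d) (R : realType)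
    (P : probability T R) (f : T -> R) : measurable_fun setT f ->
  (forall x, 0 <= f x <= 1) -> P.-integrable setT (EFin \o f).
Proof.
move=> mf f01; apply: measurable_bounded_integrable => //.
  by rewrite (le_lt_trans (probability_le1 _ _)) ?ltry.
exists 1; split=> // M M1 x _ /=; have /andP[f0 f1] := f01 x.
by rewrite ger0_norm // (le_trans f1) // ltW.
Qed.

Lemma ucoord_ext (R : realType) (k : nat) (u v : simplex R k) :
  (forall j, ucoord u j = ucoord v j) -> u = v.
Proof.
move=> uv; apply: (@val_inj _ _ (simplex_pts R k)).
by apply/rowP => j; exact: uv.
Qed.

(** The integral of [(u_j - p_j) ^ 2] is at most zero, so each coordinate is
    almost surely constant, and finitely many coordinates determine a point. *)
Lemma dirac_of_moments (R : realType) (k : nat)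
    (nu : probability (simplex R k) R) (p : simplex R k) :
  (forall j, (\int[nu]_u ucoord u j)%R = ucoord p j) ->
  (forall j, (\int[nu]_u (ucoord u j ^+ 2))%R <= ucoord p j ^+ 2) ->
  same_law nu (\d_p).
Proof.
move=> m1 m2.
have mu j : measurable_fun [set: simplex R k] (fun u => ucoord u j).
  exact: measurable_ucoord.
have iu j : nu.-integrable setT (EFin \o (fun u => ucoord u j)).
  by apply: integrable_bounded01 => // u; rewrite ucoord_ge0 ucoord_le1.
have iu2 j : nu.-integrable setT (EFin \o (fun u => ucoord u j ^+ 2)).
  apply: integrable_bounded01 => [|u]; first exact: measurable_funX.
  by rewrite exprn_ge0 ?exprn_ile1 ?ucoord_ge0 ?ucoord_le1.
have ic (c : R) : nu.-integrable setT (EFin \o (fun=> c)).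
  by apply: finite_measure_integrable_cst.
have nT : fine (nu setT) = 1 by rewrite probability_setT.
have ae_j j : {ae nu, forall u, ucoord u j = ucoord p j}.
  pose f (u : simplex R k) := (ucoord u j - ucoord p j) ^+ 2.
  have mf : measurable_fun setT f.
    by apply: measurable_funX; apply: measurable_funB.
  have f0 : (\int[nu]_u `|(f u)%:E|)%E = 0%E.
    under eq_integral => u _ do rewrite gee0_abs ?lee_fin ?sqr_ge0 //.
    have fE : f = (fun u => ucoord u j ^+ 2 - (2 * ucoord p j) * ucoord u j +
                            ucoord p j ^+ 2).
      by apply/funext => u; rewrite /f; ring.
    have i1 : nu.-integrable setT
        (EFin \o (fun u => (2 * ucoord p j) * ucoord u j)).
      exact: (integrableZl measurableT (2 * ucoord p j) (iu j)).
    have i2 : nu.-integrable setT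
        (EFin \o (fun u => ucoord u j ^+ 2 - (2 * ucoord p j) * ucoord u j)).
      exact: (integrableB measurableT (iu2 j) i1).
    have if_ : nu.-integrable setT (EFin \o f).
      by rewrite fE; exact: (integrableD measurableT i2 (ic _)).
    have fin := integrable_fin_num measurableT if_.
    rewrite -(fineK fin); congr EFin; apply/eqP; rewrite eq_le; apply/andP; split.
      rewrite -[fine _]/(\int[nu]_u f u)%R fE RintegralD // RintegralB //.
      rewrite RintegralZl // Rintegral_cst // m1 [fine _]nT.
      have := m2 j; rewrite !expr2; lra.
    by apply/fine_ge0/integral_ge0 => u _; rewrite lee_fin sqr_ge0.
  have [/(_ f0) + _] := @ae_eq_integral_abs _ _ _ nu setT measurableT _
    (proj2 (measurable_EFinP _ _) mf).
  apply: filterS => u /(_ I) /= [] /eqP; rewrite sqrf_eq0 subr_eq0.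
  by move/eqP.
have ae_p : {ae nu, forall u, u = p}.
  have : {ae nu, forall u, forall j, ucoord u j = ucoord p j}.
    exact: filter_forall.
  by apply: filterS => u; exact: ucoord_ext.
move=> A mA; have [N [mN N0 sN]] := ae_p.
have sub0 B : measurable B -> ~ B p -> nu B = 0%E.
  move=> mB Bp; apply: (subset_measure0 mB mN) => // u Bu.
  by apply: sN => /= up; apply: Bp; rewrite -up.
rewrite diracE; have [pA|pA] := boolP (p \in A); last first.
  by rewrite sub0 // => /mem_set; rewrite (negPf pA).
have := sub0 (~` A) (measurableC mA); rewrite probability_setC // => /(_ _)/eqP.
rewrite sube_eq ?fin_num_measure // add0e => /(_ _)/eqP -> //.
by apply; exact: set_mem.
Qed.

Lemma pmf_le1 (R : realType) (T : choiceType) (S : set T) (Q : T -> R)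
    (A B : T) : finite_set S -> is_pmf S Q -> S A -> S B -> A != B ->
  Q A + Q B <= 1.
Proof.
move=> fS [Q0 _ <-] SA SB AB; rewrite fsbig_finite //.
have AS : A \in fset_set S by rewrite in_fset_set // mem_set.
have BS : B \in (fset_set S `\ A)%fset.
  by rewrite in_fsetD1 eq_sym AB in_fset_set // mem_set.
rewrite (big_fsetD1 A AS) (big_fsetD1 B BS) /= lerD2l lerDl.
by apply: sumr_ge0.
Qed.

Lemma exchangeable_mixture (R : realType) (q : nat)
    (p : 'I_q -> R) (Q : mindex q -> cpart q -> R) (n : nat) (A : cpart q) :
  partially_exchangeable_structure Q -> parts n A ->
  \sum_(m \in [set m : mindex q | mnorm m = n])
    multinomial R m * (\prod_j p j ^+ m j) * Q m A =
  multinomial R (content A) * (\prod_j p j ^+ content A j) * Q (content A) A.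
Proof.
move=> [Qpmf _] /partsE[A0 An].
rewrite (fsbigE [:: content A]) //=; last 2 first.
- by move=> m /=; rewrite mem_seq1 => /eqP ->.
- move=> m mn; rewrite mem_seq1 => /eqP mA; have [_ Q0 _] := Qpmf m.
  rewrite Q0 ?mulr0 // => /parts_colorE[_ Am].
  by apply: mA; rewrite Am.
by rewrite big_cons big_nil /= mem_set // addr0.
Qed.

Lemma pESF_single (R : realType) (k : nat) (theta : R)
    (nu : probability (simplex R k) R) n (A : cpart k.+1) (c : mindex k.+1) :
  parts n A -> (forall a, a != c -> A a = 0%N) ->
  pESF theta nu n A = (n`!)%:R / rising theta n *
    (((A c)`!)%:R^-1 *
       (theta / (mnorm c)%:R * multinomial R c * moment nu c) ^+ A c).
Proof.
move=> nA Ac; rewrite /pESF mem_set //; congr (_ * _).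
rewrite (@big_finsupp_widen _ _ _ *%R (fun a n => n`!%:R^-1 *
  (theta / (mnorm a)%:R * multinomial R a * moment nu a) ^+ n) _ [fset c]%fset).
- by rewrite big_seq_fset1.
- by move=> a; rewrite fact0 invr1 mul1r.
apply/fsubsetP => a; rewrite mem_finsupp in_fset1.
by apply: contraNT => /Ac ->.
Qed.

Lemma prod_munit (R : realType) (q : nat) (p : 'I_q -> R) (j : 'I_q) :
  \prod_i p i ^+ munit j i = p j.
Proof.
rewrite (bigD1 j) //= ffunE eqxx expr1 big1 ?mulr1 // => i /negPf ij.
by rewrite ffunE ij.
Qed.

Lemma moment_munit (R : realType) (k : nat) (nu : probability (simplex R k) R) j :
  moment nu (munit j) = (\int[nu]_u ucoord u j)%R.
Proof. by apply: eq_Rintegral => u _; rewrite prod_munit. Qed.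

Lemma moment_munit2 (R : realType) (k : nat) (nu : probability (simplex R k) R) j :
  moment nu (madd (munit j) j) = (\int[nu]_u (ucoord u j ^+ 2))%R.
Proof.
by apply: eq_Rintegral => u _; rewrite monomial_madd prod_munit expr2.
Qed.

Lemma munitE (q : nat) (j : 'I_q) : munit j = madd (midx0 q) j.
Proof. by apply/ffunP => i; rewrite !ffunE. Qed.

Lemma multinomial_munit (R : realType) (q : nat) (j : 'I_q) :
  multinomial R (munit j) = 1.
Proof.
rewrite /multinomial munitE mnorm_madd prod_fact_madd mnorm0 ffunE.
by rewrite big1 ?divr1 // => i _; rewrite ffunE.
Qed.

Lemma multinomial_munit2 (R : realType) (q : nat) (j : 'I_q) :
  multinomial R (madd (munit j) j) = 1.
Proof.
rewrite /multinomial munitE !mnorm_madd !prod_fact_madd mnorm0 !ffunE eqxx.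
rewrite big1 ?muln1 ?divff ?pnatr_eq0 // => i _; by rewrite ffunE.
Qed.

Lemma parts_color_munit (q : nat) (j : 'I_q) :
  parts_color (munit j) = [set add_block [fsfun] (munit j) : cpart q].
Proof.
apply/seteqP; split=> A.
  move=> jA; have /parts_colorE[_ Aj] := jA.
  have [a aA aj] : exists2 a, a \in finsupp A & (0 < a j)%N.
    by apply: exists_deletion; rewrite Aj munitE madd_gt0.
  have := parts_color_delete jA aA aj.
  rewrite munitE maddK parts_color0E /= => dE.
  have := mpred_mem A aj; rewrite dE finsupp0 fsetU0 in_fset1 => /eqP m0.
  by rewrite -(deleteK aA aj) dE m0 /insert eqxx.
move=> ->; rewrite munitE.
have := @parts_color_insert q (midx0 q) j [fsfun] (midx0 q).
rewrite /insert eqxx; apply; last by rewrite fset1U1.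
by rewrite parts_color0E.
Qed.

(** Sizes 1 and 2 suffice: size 1 identifies [p_j] with the mean of [u_j], and
    in size 2 the two partitions of two elements of colour [j] have together
    probability [(E u_j ^ 2 + theta (E u_j) ^ 2) / (theta + 1)], which the
    mixture representation bounds by [p_j ^ 2]. *)
Lemma dirac_of_exchangeable (R : realType) (k : nat) (theta : R)
    (nu : probability (simplex R k) R) : 0 < theta ->
  partially_exchangeable_type (pESF theta nu) ->
  exists p : simplex R k, same_law nu (\d_p).
Proof.
move=> t0 [_ [p [Q [QS PQ]]]]; exists p.
have PE n (A : cpart k.+1) : parts n A -> pESF theta nu n A =
    multinomial R (content A) * (\prod_j ucoord p j ^+ content A j) *
    Q (content A) A.
  by move=> nA; rewrite PQ (exchangeable_mixture _ QS nA).
have [Qpmf _] := QS.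
have r1 : rising theta 1 = theta by rewrite risingS /rising big_ord0 mul1r addr0.
have r2 : rising theta 2 = theta * (theta + 1) by rewrite risingS r1.
have tn0 : theta != 0 by rewrite gt_eqF.
have t10 : theta + 1 != 0 by rewrite gt_eqF // addr_gt0.
have E0 (a : mindex k.+1) : ([fsfun] : cpart k.+1) a = 0%N by rewrite fsfun0E.
have nm1 (j : 'I_k.+1) : mnorm (munit j) = 1%N by rewrite munitE mnorm_madd mnorm0.
pose A1 (j : 'I_k.+1) : cpart k.+1 := add_block [fsfun] (munit j).
have cA1 j : parts_color (munit j) (A1 j) by rewrite parts_color_munit.
have m1 j : moment nu (munit j) = ucoord p j.
  have P1 : parts 1 (A1 j) by rewrite -(nm1 j); exact: sub_parts_color.
  have /parts_colorE[_ c1] := cA1 j.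
  have := PE _ _ P1; rewrite c1 multinomial_munit prod_munit mul1r.
  have [_ _] := Qpmf (munit j); rewrite parts_color_munit fsbig_set1 => ->.
  rewrite mulr1 (pESF_single _ _ (c := munit j) P1); last first.
    by move=> a /negPf aj; rewrite add_blockE E0 aj.
  rewrite add_blockE E0 eqxx nm1 r1 multinomial_munit expr1 => <-.
  by rewrite factS fact0; field.
apply: dirac_of_moments => j; first by rewrite -moment_munit.
pose jj := madd (munit j) j.
pose A2 : cpart k.+1 := add_block [fsfun] jj.
pose A11 : cpart k.+1 := add_block (A1 j) (munit j).
have nm2 : mnorm jj = 2%N by rewrite mnorm_madd nm1.
have j0 : munit j != midx0 k.+1 by rewrite munitE madd_neq0.
have jj0 : jj != midx0 k.+1 by rewrite madd_neq0.
have jjj : jj != munit j by apply/eqP => /(congr1 (@mnorm _)); rewrite nm1 nm2.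
have ce i : content ([fsfun] : cpart k.+1) i = 0%N by rewrite ffunE finsupp0 big_nil.
have c2 : parts_color jj A2.
  apply/parts_colorE; split; first by rewrite add_blockE E0 eq_sym (negPf jj0).
  by apply/ffunP => i; rewrite content_add_block ce.
have c11 : parts_color jj A11.
  apply/parts_colorE; split.
    by rewrite !add_blockE E0 eq_sym (negPf j0).
  by apply/ffunP => i; rewrite !content_add_block ce !ffunE.
have P2 : parts 2 A2 by rewrite -nm2; exact: sub_parts_color.
have P11 : parts 2 A11 by rewrite -nm2; exact: sub_parts_color.
have A2E : pESF theta nu 2 A2 = moment nu jj / (theta + 1).
  rewrite (pESF_single _ _ (c := jj) P2); last first.
    by move=> a /negPf aj; rewrite add_blockE E0 aj.
  rewrite add_blockE E0 eqxx nm2 r2 multinomial_munit2 expr1.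
  by rewrite !factS fact0; field; rewrite tn0 t10.
have A11E : pESF theta nu 2 A11 = theta * moment nu (munit j) ^+ 2 / (theta + 1).
  rewrite (pESF_single _ _ (c := munit j) P11); last first.
    by move=> a /negPf aj; rewrite !add_blockE E0 aj.
  rewrite !add_blockE E0 eqxx nm1 r2 multinomial_munit.
  by rewrite !factS fact0; field; rewrite tn0 t10.
have A2n11 : A2 != A11.
  apply/eqP => /fsfunP/(_ jj); rewrite !add_blockE E0 eqxx.
  by rewrite (negPf jjj).
have Qle := pmf_le1 (finite_parts_color jj) (Qpmf jj) c2 c11 A2n11.
have : pESF theta nu 2 A2 + pESF theta nu 2 A11 <= ucoord p j ^+ 2.
  have /parts_colorE[_ e2] := c2; have /parts_colorE[_ e11] := c11.
  rewrite !PE // e2 e11 -mulrDr multinomial_munit2 monomial_madd prod_munit mul1r.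
  by rewrite -expr2 ler_piMr // sqr_ge0.
rewrite A2E A11E -mulrDl ler_pdivrMr ?addr_gt0 // m1 -moment_munit2 -/jj.
rewrite mulrDr mulr1 [ucoord p j ^+ 2 * theta]mulrC addrC lerD2l.
by [].
Qed.

(** * Expectations of independent variables *)

Import HBNNSimple.

(** A change of variables that starts from indicators only. Independence and
    laws with a density are given on events; this lemma transfers them to
    expectations. Both sides are linear on simple functions and continuous along
    increasing sequences. *)
Lemma integral_weighted_law d d1 (Omega : measurableType d)
    (T : measurableType d1) (R : realType) (P : {measure set Omega -> \bar R})
    (mu : {measure set T -> \bar R}) (phi : Omega -> T) (g : Omega -> R) (c : R) :
  measurable_fun setT phi -> measurable_fun setT g ->
  (forall x, 0 <= g x) -> 0 <= c ->
  (forall B, measurable B ->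
     (\int[P]_x (\1_B (phi x) * g x)%:E = c%:E * mu B)%E) ->
  forall f : T -> R, measurable_fun setT f -> (forall y, 0 <= f y) ->
  (\int[P]_x (f (phi x) * g x)%:E = c%:E * \int[mu]_y (f y)%:E)%E.
Proof.
move=> mphi mg g0 c0 indicP f mf f0.
have simpleP (h : {nnsfun T >-> R}) :
    (\int[P]_x (h (phi x) * g x)%:E = c%:E * \int[mu]_y (h y)%:E)%E.
  under eq_integral => x _.
    rewrite [h (phi x)]fimfunE mulr_fsuml -fsumEFin //; over.
  have mS r : measurable_fun setT (fun x => \1_(h @^-1` [set r]) (phi x) : R).
    have mB : measurable (h @^-1` [set r]) by exact: measurable_sfunP.
    exact: (measurableT_comp (measurable_indic (D := setT) mB) mphi).
  rewrite ge0_integral_fsum //; last 2 first.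
  - move=> r; apply/measurable_EFinP/measurable_funM => //.
    exact: measurable_funM.
  - move=> r x _; rewrite lee_fin mulr_ge0 //; exact: (nnfun_muleindic_ge0 h).
  rewrite integralT_nnsfun sintegralE ge0_mule_fsumr; last first.
    by move=> r; exact: nnsfun_mulemu_ge0.
  apply: eq_fsbigr => r /set_mem [y _ hy].
  have r0 : 0 <= r by rewrite -hy; exact: fun_ge0.
  under eq_integral do rewrite -mulrA EFinM.
  rewrite ge0_integralZl_EFin //.
  - by rewrite indicP // muleCA.
  - by move=> x _; rewrite lee_fin mulr_ge0.
  - exact/measurable_EFinP/measurable_funM.
have mEf : measurable_fun setT (EFin \o f) by exact/measurable_EFinP.
have Ef0 y : setT y -> (0 <= (EFin \o f) y)%E by rewrite lee_fin.
pose h := nnsfun_approx measurableT mEf.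
have hcvg y : (h n y)%:E @[n --> \oo] --> (f y)%:E.
  exact: (cvg_nnsfun_approx measurableT mEf Ef0).
have hnd y : {homo (fun n => h n y) : m n / (m <= n)%N >-> m <= n}.
  by move=> m n mn; exact/lefP/nd_nnsfun_approx.
have LP : (\int[P]_x (h n (phi x) * g x)%:E)%E @[n --> \oo] -->
    (\int[P]_x (f (phi x) * g x)%:E)%E.
  rewrite [X in _ --> X](_ : _ =
    (\int[P]_x (limn (fun n => (h n (phi x) * g x)%:E)))%E); last first.
    apply: eq_integral => x _; apply/esym/cvg_lim => //.
    by under eq_fun do rewrite EFinM; rewrite EFinM; exact: cvgeZr.
  apply: cvg_monotone_convergence => //.
  - move=> n; apply/measurable_EFinP/measurable_funM => //.
    exact: measurableT_comp.
  - by move=> n x _; rewrite lee_fin mulr_ge0.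
  - by move=> x _ m n mn; rewrite lee_fin ler_wpM2r // hnd.
have LM : (\int[mu]_y (h n y)%:E)%E @[n --> \oo] --> (\int[mu]_y (f y)%:E)%E.
  rewrite [X in _ --> X](_ : _ = (\int[mu]_y (limn (fun n => (h n y)%:E)))%E).
    apply: cvg_monotone_convergence => //.
    - by move=> n; exact/measurable_EFinP.
    - by move=> n y _; rewrite lee_fin.
    - by move=> y _ m n mn; rewrite lee_fin hnd.
  by apply: eq_integral => y _; apply/esym/cvg_lim.
have LM' : (\int[P]_x (h n (phi x) * g x)%:E)%E @[n --> \oo] -->
    (c%:E * \int[mu]_y (f y)%:E)%E.
  by under eq_fun do rewrite simpleP; exact: cvgeZl.
exact: (cvg_unique _ LP LM').
Qed.

Lemma integral_preimage d d1 (Omega : measurableType d)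
    (T : measurableType d1) (R : realType) (P : probability Omega R)
    (X : Omega -> T) (f : T -> R) : measurable_fun setT X ->
  measurable_fun setT f -> (forall y, 0 <= f y) ->
  (\int[pushforward P X]_y (f y)%:E = \int[P]_w (f (X w))%:E)%E.
Proof.
move=> mX mf f0; rewrite ge0_integral_pushforward //; first exact/measurable_EFinP.
by move=> y _; rewrite lee_fin.
Qed.

Lemma measurable_indic_comp d d1 (Omega : measurableType d)
    (T : measurableType d1) (R : realType) (X : Omega -> T) (B : set T) :
  measurable_fun setT X -> measurable B ->
  measurable_fun setT (fun w => \1_B (X w) : R).
Proof.
by move=> mX mB; exact: (measurableT_comp (measurable_indic (D := setT) mB) mX).
Qed.

(** The transfer from events to functions is done in [X] first, for a fixed
    event of [Y], and then in [Y], for the fixed function of [X]. *)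
Lemma expectation_independent d d1 d2 (Omega : measurableType d)
    (T1 : measurableType d1) (T2 : measurableType d2) (R : realType)
    (P : probability Omega R) (X : Omega -> T1) (Y : Omega -> T2)
    (f : T1 -> R) (h : T2 -> R) :
  independent P X Y -> measurable_fun setT X -> measurable_fun setT Y ->
  measurable_fun setT f -> measurable_fun setT h ->
  (forall y, 0 <= f y) -> (forall y, 0 <= h y) ->
  (\int[P]_w (f (X w))%:E < +oo)%E ->
  (\int[P]_w (f (X w) * h (Y w))%:E =
   \int[P]_w (f (X w))%:E * \int[P]_w (h (Y w))%:E)%E.
Proof.
move=> XY mX mY mf mh f0 h0 foo.
have If0 : (0 <= \int[P]_w (f (X w))%:E)%E by apply: integral_ge0 => w _; rewrite lee_fin.
have fE : (\int[P]_w (f (X w))%:E)%E \is a fin_num by rewrite ge0_fin_numE.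
rewrite -(fineK fE) -(integral_preimage P mY mh h0).
under eq_integral do rewrite mulrC.
apply: integral_weighted_law => //.
- exact: measurableT_comp.
- exact: fine_ge0.
move=> B mB.
have PB : P (Y @^-1` B) \is a fin_num.
  by rewrite fin_num_measure // -[_ @^-1` _]setTI; exact: mY.
under eq_integral do rewrite mulrC.
rewrite (@integral_weighted_law _ _ _ _ _ P (pushforward P X) X
  (fun w => \1_B (Y w)) (fine (P (Y @^-1` B)))) //.
- by rewrite integral_preimage // !fineK // muleC.
- exact: measurable_indic_comp.
- exact: fine_ge0.
move=> A mA; rewrite fineK // muleC -XY //.
rewrite -[X in _ = P X]setIT -integral_indic; last 2 first.
- exact: measurableT.
- by apply: measurableI; rewrite -[_ @^-1` _]setTI; [exact: mX|exact: mY].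
by apply: eq_integral => w _; rewrite indicI.
Qed.

Lemma expectation_mutually_independent d d1 (Omega : measurableType d)
    (T : measurableType d1) (R : realType) (P : probability Omega R)
    (X : nat -> Omega -> T) (f : nat -> T -> R) (c : nat -> R) (s : seq nat) :
  mutually_independent P X -> (forall i, measurable_fun setT (X i)) ->
  (forall i, measurable_fun setT (f i)) -> (forall i y, 0 <= f i y) ->
  (forall i, (\int[P]_w (f i (X i w))%:E = (c i)%:E)%E) -> uniq s ->
  (\int[P]_w (\prod_(i <- s) f i (X i w))%:E = (\prod_(i <- s) c i)%:E)%E.
Proof.
move=> Xind mX mf f0 fc.
have c0 i : 0 <= c i.
  by rewrite -lee_fin -fc; apply: integral_ge0 => w _; rewrite lee_fin.
have mXB i (B : set T) : measurable B -> measurable (X i @^-1` B).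
  by move=> mB; rewrite -[_ @^-1` _]setTI; exact: mX.
have finX i (B : set T) : measurable B -> P (X i @^-1` B) \is a fin_num.
  by move=> mB; rewrite fin_num_measure //; exact: mXB.
(* Some of the functions are kept equal to indicators, so that each step may
   vary the set of one indicator. *)
suff gen t (B : nat -> set T) : (forall i, measurable (B i)) -> uniq (s ++ t) ->
    (\int[P]_w ((\prod_(i <- s) f i (X i w)) *
               (\prod_(i <- t) \1_(B i) (X i w)))%:E =
    ((\prod_(i <- s) c i) * \prod_(i <- t) fine (P (X i @^-1` B i)))%:E)%E.
  move=> us; have := gen [::] (fun=> setT); rewrite cats0 => /(_ _ us).
  by under eq_integral do rewrite big_nil mulr1; rewrite big_nil mulr1; apply.
elim: s t B => [|i s IHs] t B mB /=.
  move=> ut; rewrite big_nil mul1r.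
  have := Xind [fset i in t]%fset B mB.
  have pt : perm_eq [fset i in t]%fset t.
    by apply: uniq_perm => // i; rewrite in_fset.
  rewrite (perm_big _ pt) /= => PB; rewrite -prodEFin.
  rewrite (eq_bigr (fun i => P (X i @^-1` B i))) -?PB; last first.
    by move=> i _; rewrite fineK //; exact: finX.
  rewrite -[X in _ = P X]setIT -integral_indic //; last first.
    apply: fin_bigcap_measurable => // i _; exact: mXB.
  apply: eq_integral => w _; rewrite big_nil mul1r; congr EFin.
  rewrite indicE; have [/set_mem wB|wB] := boolP (w \in _).
    rewrite big1_seq // => i /andP[_ it]; rewrite indicE mem_set //.
    by apply: wB; rewrite /= in_fset.
  have [i it wBi] : exists2 i, i \in t & ~ B i (X i w).
    apply: contrapT => /forall2NP nB; move/negP: wB; apply; apply/mem_set => i /=.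
    by rewrite in_fset => it; have [//|/contrapT] := nB i.
  by rewrite (big_rem i) //= indicE memNset // mul0r.
case/andP => ist ust; rewrite big_cons.
pose g w := (\prod_(i <- s) f i (X i w)) * (\prod_(i <- t) \1_(B i) (X i w)).
pose C := (\prod_(i <- s) c i) * \prod_(i <- t) fine (P (X i @^-1` B i)).
have mprod (r : seq nat) (h : nat -> T -> R) : (forall i, measurable_fun setT (h i)) ->
    measurable_fun setT (fun w => \prod_(i <- r) h i (X i w)).
  by move=> mh; apply: measurable_prod => k _; exact: measurableT_comp.
under eq_integral do rewrite big_cons -mulrA.
rewrite (@integral_weighted_law _ _ _ _ _ P (pushforward P (X i)) (X i) g C) //.
- by rewrite integral_preimage // fc -EFinM /C mulrC mulrA.
- apply: measurable_funM; first exact: mprod.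
  by apply: measurable_prod => k _; exact: measurable_indic_comp.
- by move=> w; rewrite mulr_ge0 // prodr_ge0.
- by rewrite mulr_ge0 // prodr_ge0 // => k _; rewrite fine_ge0.
move=> A mA; pose B' k := if k == i then A else B k.
have mB' k : measurable (B' k) by rewrite /B'; case: ifP.
have := IHs (i :: t) B' mB'.
have -> : uniq (s ++ i :: t) by rewrite -[i :: t]cat1s uniq_catCA /= ist.
move=> /(_ isT).
have B'i : B' i = A by rewrite /B' eqxx.
have B't k : k \in t -> B' k = B k.
  by rewrite /B'; case: eqP => // -> it; rewrite mem_cat it orbT in ist.
have Et : \prod_(k <- t) fine (P (X k @^-1` B' k)) =
          \prod_(k <- t) fine (P (X k @^-1` B k)).
  by apply: eq_big_seq => k kt; rewrite B't.
rewrite [X in _ * X](big_cons) B'i Et mulrCA EFinM -/C muleC fineK ?finX // => <-.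
apply: eq_integral => w _; rewrite big_cons B'i /g mulrCA.
congr (EFin (_ * (_ * _))).
by apply: eq_big_seq => k kt; rewrite B't.
Qed.

(** * Second moments of the Poisson-Dirichlet distribution *)

Lemma integral_powR_onem (R : realType) (c : R) : 0 < c ->
  (\int[lebesgue_measure]_(t in `]0%R, 1%R[) ((1 - t) `^ (c - 1))%:E = (c^-1)%:E)%E.
Proof.
move=> c0; pose f (t : R) := (1 - t) `^ (c - 1).
pose F (t : R) := - (c^-1 * (1 - t) `^ c).
have dpow (e t : R) : t < 1 ->
    is_derive t 1 (fun t : R => (1 - t) `^ e) (- (e * (1 - t) `^ (e - 1))).
  move=> t1; have t10 : 0 < 1 - t by rewrite subr_gt0.
  have d1 : is_derive t (1 : R) (cst (1 : R) - id) (0 - 1) by exact: is_deriveB.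
  have dp : is_derive ((cst 1 - id) t) 1 (@powR R ^~ e) (e * (1 - t) `^ (e - 1)).
    exact: is_derive1_powR.
  have := is_derive1_comp dp d1.
  by rewrite sub0r mulrN1.
have dF (t : R) : t < 1 -> is_derive t 1 F (f t).
  move=> t1; have := is_deriveN (is_deriveZ c^-1 (dpow c t t1)).
  by rewrite scalerN opprK /GRing.scale /= mulKf ?gt_eqF.
have cvF (t : R) : t < 1 -> {for t, continuous F}.
  move=> t1; apply: differentiable_continuous.
  by apply/derivable1_diffP; have [] := dF t t1.
have cf (t : R) : t < 1 -> {for t, continuous f}.
  move=> t1; apply: differentiable_continuous.
  by apply/derivable1_diffP; have [] := dpow (c - 1) t t1.
(* For [c < 1] the integrand explodes at 1, so the interval is exhausted by
   the segments [[0, b n]]. *)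
pose b n : R := 1 - n.+2%:R^-1.
have b0 n : 0 < b n.
  by rewrite subr_gt0 invf_lt1 // ltr1n.
have b1 n : b n < 1 by rewrite ltrBlDr ltrDl invr_gt0.
have step n : (\int[lebesgue_measure]_(t in `[0%R, b n]) (f t)%:E =
    (F (b n))%:E - (F 0)%:E)%E.
  apply: continuous_FTC2 => //.
  - apply: continuous_in_subspaceT => t; rewrite inE /= in_itv /= => /andP[_ tb].
    by apply: cf; exact: le_lt_trans tb (b1 n).
  - split.
    + move=> t; rewrite in_itv /= => /andP[_ tb].
      by have [] := dF t (lt_trans tb (b1 n)).
    + by apply: cvg_at_right_filter; exact: cvF.
    + by apply: cvg_at_left_filter; exact: cvF.
  - move=> t; rewrite in_itv /= => /andP[_ tb].
    by rewrite derive1E; have [_ ->] := dF t (lt_trans tb (b1 n)).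
have U : \bigcup_n `[0%R, b n]%classic = `[0%R, 1%R[%classic.
  apply/seteqP; split=> t /=.
    move=> [n _] /=; rewrite !in_itv /= => /andP[-> tb].
    exact: le_lt_trans tb (b1 n).
  rewrite in_itv /= => /andP[t0 t1].
  have [k tk] := ltr_add_invr t1; exists k => //=.
  rewrite in_itv /= t0 lerBrDr; apply/ltW/(le_lt_trans _ tk).
  by rewrite lerD2l lef_pV2 ?posrE // ler_nat.
have mf : measurable_fun setT f.
  apply: (measurableT_comp (measurable_powR (c - 1))).
  exact: measurable_funB.
have L1 : (\int[lebesgue_measure]_(t in `[0%R, b n]) (f t)%:E)%E @[n --> \oo] -->
    (\int[lebesgue_measure]_(t in `[0%R, 1%R[) (f t)%:E)%E.
  rewrite -U; apply: ge0_nondecreasing_set_cvg_integral => //.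
  - apply/nondecreasing_seqP => n; apply/subsetPset => t /=.
    rewrite !in_itv /= => /andP[-> /le_trans]; apply.
    by rewrite lerD2l lerN2 lef_pV2 ?posrE // ler_nat.
  - by move=> n; apply/measurable_EFinP/measurable_funTS.
  - by move=> n t _; rewrite lee_fin powR_ge0.
have L2 : (\int[lebesgue_measure]_(t in `[0%R, b n]) (f t)%:E)%E @[n --> \oo] -->
    (c^-1)%:E.
  under eq_fun do rewrite step -EFinB.
  apply: cvg_EFin; first by near=> n.
  rewrite /F /= subr0 powR1 mulr1.
  rewrite [X in _ --> X](_ : _ = - (c^-1 * 0) - - c^-1); last first.
    by rewrite mulr0 oppr0 sub0r opprK.
  apply: cvgB; last exact: cvg_cst.
  apply: cvgN; apply: cvgZr.
  under eq_fun do rewrite /b subKr.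
  have [+ _] := cvg_at_rightP (fun a : R => a `^ c) 0 0.
  move=> /(_ (powR_cvg0 c0)); apply; split; first by move=> n; rewrite invr_gt0.
  by rewrite (cvg_shiftS (@harmonic R)); exact: cvg_harmonic.
rewrite integral_itv_obnd_cbnd; last exact/measurable_EFinP/measurable_funTS.
exact: (cvg_unique _ L1 L2).
Unshelve. all: by end_near.
Qed.

Lemma beta_law_integral (R : realType) (theta : R)
    (mu : {measure set R -> \bar R}) (f : R -> R) : 0 < theta ->
  same_law mu (beta_law 1 theta) ->
  measurable_fun setT f -> (forall t, 0 <= f t) ->
  (\int[lebesgue_measure]_(t in `]0%R, 1%R[) (f t * (1 - t) `^ (theta - 1))%:E =
   (theta^-1)%:E * \int[mu]_t (f t)%:E)%E.
Proof.
move=> t0 mulaw mf f0.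
pose g (t : R) := (1 - t) `^ (theta - 1) * \1_(`]0%R, 1%R[%classic) t.
have mp : measurable_fun setT (fun t : R => (1 - t) `^ (theta - 1)).
  apply: (measurableT_comp (measurable_powR (theta - 1))).
  exact: measurable_funB.
have gE (D : set R) (h : R -> R) :
    (\int[lebesgue_measure]_(t in D `&` `]0%R, 1%R[) (h t * (1 - t) `^ (theta - 1))%:E
     = \int[lebesgue_measure]_(t in D) (h t * g t)%:E)%E.
  rewrite integral_mkcondr; apply: eq_integral => t _.
  rewrite /g patchE indicE; case: (_ \in _); by rewrite ?mulr1 ?mulr0.
rewrite -[X in integral _ X](setTI) gE.
apply: (@integral_weighted_law _ _ _ _ _ lebesgue_measure mu id) => //.
- by apply: measurable_funM => //; exact: measurable_indic.
- by move=> t; rewrite mulr_ge0 ?powR_ge0.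
- by rewrite invr_ge0 ltW.
move=> B mB; rewrite mulaw // /beta_law.
have kE (D : set R) :
    (\int[lebesgue_measure]_(t in D) (beta_kernel 1 theta t)%:E =
     \int[lebesgue_measure]_(t in D) ((1 - t) `^ (theta - 1))%:E)%E.
  by apply: eq_integral => t _; rewrite /beta_kernel subrr powRr0 mul1r.
rewrite !kE integral_powR_onem // inver gt_eqF ?invr_gt0 // invrK.
rewrite muleCA -EFinM mulVf ?gt_eqF // mule1.
rewrite [RHS](_ : _ = \int[lebesgue_measure]_(t in B) (1 * g t)%:E)%E; last first.
  by rewrite -(gE B (fun=> 1)); apply: eq_integral => t _; rewrite mul1r.
rewrite [RHS]integral_mkcond; apply: eq_integral => t _.
by rewrite patchE indicE; case: (_ \in _); rewrite ?mul0r ?mul1r.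
Qed.

Lemma beta_law_moments (R : realType) (theta : R)
    (mu : {measure set R -> \bar R}) : 0 < theta ->
  same_law mu (beta_law 1 theta) ->
  (\int[mu]_t (t ^+ 2)%:E = (2 / ((theta + 1) * (theta + 2)))%:E)%E /\
  (\int[mu]_t ((1 - t) ^+ 2)%:E = (theta / (theta + 2))%:E)%E.
Proof.
move=> t0 mulaw; pose k (c t : R) : R := (1 - t) `^ (c - 1).
have I c := @integral_powR_onem R c.
have mk c : measurable_fun (`]0%R, 1%R[%classic : set R) (EFin \o k c).
  apply/measurable_EFinP/measurable_funTS.
  apply: (measurableT_comp (measurable_powR (c - 1))).
  exact: measurable_funB.
have kS c (t : R) : 0 < c -> `]0%R, 1%R[%classic t -> (1 - t) * k c t = k (c + 1) t.
  rewrite /= in_itv /= => c0 /andP[_ t1].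
  by rewrite mulr_powRB1 ?subr_ge0 ?(ltW t1) // /k addrK.
have t1 : 0 < theta + 1 by rewrite addr_gt0.
have t2 : 0 < theta + 1 + 1 by rewrite addr_gt0.
have m1 : measurable_fun setT (fun t : R => 1 - t) by exact: measurable_funB.
have k2 (t : R) : `]0%R, 1%R[%classic t -> (1 - t) ^+ 2 * k theta t = k (theta + 1 + 1) t.
  by move=> t01; rewrite expr2 -mulrA kS // kS.
have E1 : (\int[mu]_t ((1 - t) ^+ 2)%:E = (theta / (theta + 2))%:E)%E.
  have := beta_law_integral t0 mulaw (measurable_funX 2 m1) (fun t => sqr_ge0 _).
  have J : (\int[lebesgue_measure]_(t in `]0%R, 1%R[)
      ((1 - t) ^+ 2 * (1 - t) `^ (theta - 1))%:E = ((theta + 1 + 1)^-1)%:E)%E.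
    rewrite -(I _ t2); apply: eq_integral => t /set_mem t01.
    by congr EFin; exact: k2.
  rewrite J => /(congr1 (fun x => theta%:E * x)%E).
  rewrite muleA -!EFinM divff ?gt_eqF // mul1e => <-.
  by rewrite -addrA.
split=> //.
pose E2 : \bar R := (\int[mu]_t (t ^+ 2)%:E)%E.
have := beta_law_integral t0 mulaw
  (measurable_funX 2 (@measurable_id _ _ setT)) (fun t => sqr_ge0 _).
rewrite -/E2 => EE.
(* The identity [t ^ 2 + 2 (1 - t) = 1 + (1 - t) ^ 2] has nonnegative terms
   only, so it can be integrated without checking integrability. *)
have S : ((theta^-1)%:E * E2 + (2 * (theta + 1)^-1)%:E =
    (theta^-1 + (theta + 1 + 1)^-1)%:E)%E.
  rewrite -EE EFinM -(I _ t1) -ge0_integralZl_EFin //; last 2 first.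
  - by move=> t _; rewrite lee_fin powR_ge0.
  - exact: mk.
  rewrite [RHS]EFinD -(I _ t0) -(I _ t2) -!ge0_integralD //.
  - apply: eq_integral => t /set_mem t01; rewrite -!EFinM -!EFinD; congr EFin.
    rewrite -!/(k _ _) -k2 // -kS //; ring.
  - by move=> t _; rewrite lee_fin powR_ge0.
  - exact: mk.
  - by move=> t _; rewrite lee_fin powR_ge0.
  - exact: mk.
  - by move=> t _; rewrite lee_fin mulr_ge0 ?powR_ge0 ?sqr_ge0.
  - apply/measurable_EFinP/measurable_funM.
      exact: measurable_funX.
    by have /measurable_EFinP := mk theta.
  - by move=> t _; rewrite -EFinM lee_fin mulr_ge0 ?powR_ge0.
  - apply: emeasurable_funM => //; exact: mk.
have E20 : (0 <= E2)%E by apply: integral_ge0 => t _; rewrite lee_fin sqr_ge0.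
case: E2 E20 S {EE} => [r _|_|//]; last first.
  by rewrite gt0_muley ?lte_fin ?invr_gt0.
rewrite -EFinM -EFinD => -[S]; congr EFin.
have -> : r = theta * (theta^-1 * r) by rewrite mulrA divff ?gt_eqF // mul1r.
have -> : theta^-1 * r = theta^-1 + (theta + 1 + 1)^-1 - 2 * (theta + 1)^-1.
  by rewrite -S addrK.
field; rewrite !gt_eqF // ?addr_gt0 //.
Qed.

Lemma measurable_seq_coord d (T : measurableType d) (n : nat) :
  measurable_fun setT (fun x : seqspace T => x n).
Proof.
move=> _ B mB; rewrite setTI; apply: sub_sigma_algebra.
by exists n, B.
Qed.

Lemma nneseries_rearrangement (R : realType) (l w : nat -> R) :
  decreasing_rearrangement l w ->
  (\sum_(i <oo) (l i ^+ 2)%:E = \sum_(i <oo) (w i ^+ 2)%:E)%E.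
Proof.
move=> [_ [s sbij ls]].
rewrite !nneseries_esumT; try by move=> i; rewrite lee_fin sqr_ge0.
rewrite [RHS](@reindex_esum _ _ _ setT setT s).
  by apply: eq_esum => i _; rewrite ls.
by rewrite setTT_bijective.
Qed.

Lemma expectation_stick_sq d (Omega : measurableType d) (R : realType)
    (P : probability Omega R) (V : nat -> Omega -> R) (a r : R) (i : nat) :
  mutually_independent P V -> (forall m, measurable_fun setT (V m)) ->
  (forall m, \int[P]_w (V m w ^+ 2)%:E = a%:E)%E ->
  (forall m, \int[P]_w ((1 - V m w) ^+ 2)%:E = r%:E)%E ->
  (\int[P]_w (stick (fun m => V m w) i ^+ 2)%:E = (a * r ^+ i)%:E)%E.
Proof.
move=> Vind mV Va Vr.
(* The squared stick is the product of [V_i ^ 2] and of the [(1 - V_m) ^ 2]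
   for [m < i]. *)
pose f m (t : R) := if m == i then t ^+ 2 else (1 - t) ^+ 2.
pose c m := if m == i then a else r.
have mf m : measurable_fun setT (f m).
  rewrite /f; case: (m == i); apply: measurable_funX; first exact: measurable_id.
  exact: measurable_funB.
have f0 m y : 0 <= f m y by rewrite /f; case: ifP => _; exact: sqr_ge0.
have fc m : (\int[P]_w (f m (V m w))%:E = (c m)%:E)%E.
  by rewrite /f /c; case: ifP => _.
have := expectation_mutually_independent Vind mV mf f0 fc (iota_uniq 0 i.+1).
have split_last (h : nat -> R) :
    \prod_(m <- iota 0 i.+1) h m = h i * \prod_(m < i) h m.
  by rewrite -[iota 0 i.+1]/(index_iota 0 i.+1) big_mkord big_ord_recr mulrC.
under eq_integral do rewrite split_last.
rewrite split_last /c eqxx (eq_bigr (fun=> r)); last first.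
  by move=> m _; rewrite ltn_eqF.
rewrite prodr_const card_ord => <-; apply: eq_integral => w _.
rewrite /stick exprMn -prodrXl /f eqxx; congr (EFin (_ * _)).
by apply: eq_bigr => m _; rewrite ltn_eqF.
Qed.

Lemma nneseries_geometric (R : realType) (a r : R) : 0 <= r < 1 ->
  (\sum_(i <oo) (a * r ^+ i)%:E = (a / (1 - r))%:E)%E.
Proof.
move=> /andP[r0 r1]; apply/cvg_lim => //.
under eq_fun do rewrite sumEFin.
apply: cvg_EFin; first by near=> n.
by apply: cvg_geometric_series; rewrite ger0_norm.
Unshelve. all: by end_near.
Qed.

(** The expected sum of squares is invariant under rearrangement, so that it
    can be computed from the sticks, whose squares have means in geometric
    progression. *)
Lemma poisson_dirichlet_sum_sq d (Omega : measurableType d) (R : realType)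
    (P : probability Omega R) (l : {RV P >-> seqspace R}) (theta : R) :
  0 < theta -> poisson_dirichlet theta (distribution P l) ->
  (\sum_(i <oo) \int[P]_w (l w i ^+ 2)%:E = ((theta + 1)^-1)%:E)%E.
Proof.
move=> t0 [d2 [Om2 [P2 [V [l2 [Vind Vlaw Vl' ll']]]]]].
have mc i : measurable_fun setT (fun x : seqspace R => x i ^+ 2).
  by apply: measurable_funX; exact: measurable_seq_coord.
have mV i : measurable_fun setT (V i : Om2 -> R) by exact: measurable_funPT.
have lE i : (\int[P]_w (l w i ^+ 2)%:E = \int[P2]_w (l2 w i ^+ 2)%:E)%E.
  have ml : measurable_fun setT l by exact: measurable_funPT.
  have ml' : measurable_fun setT l2 by exact: measurable_funPT.
  rewrite -(integral_preimage P ml (mc i)); last by move=> x; exact: sqr_ge0.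
  rewrite -(integral_preimage P2 ml' (mc i)); last by move=> x; exact: sqr_ge0.
  by apply: eq_measure_integral => A mA _; exact: ll'.
under eq_eseriesr do rewrite lE.
have mS i : measurable_fun setT (fun w => stick (fun m => V m w) i ^+ 2).
  apply: measurable_funX; apply: measurable_funM => //.
  by apply: measurable_prod => m _; exact: measurable_funB.
have ml2 i : measurable_fun setT (fun w => l2 w i ^+ 2).
  apply: (measurableT_comp (mc i)); exact: measurable_funPT.
have moments i := beta_law_moments t0 (Vlaw i).
rewrite -integral_nneseries //; last 2 first.
- by move=> i; exact/measurable_EFinP.
- by move=> i w _; rewrite lee_fin sqr_ge0.
rewrite (@ae_eq_integral _ _ _ P2 setT
  (fun w => \sum_(i <oo) (stick (fun m => V m w) i ^+ 2)%:E)%E); last 4 first.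
- exact: measurableT.
- apply: ge0_emeasurable_sum => [i w _ _|i _]; first by rewrite lee_fin sqr_ge0.
  exact/measurable_EFinP.
- apply: ge0_emeasurable_sum => [i w _ _|i _]; first by rewrite lee_fin sqr_ge0.
  exact/measurable_EFinP.
- by apply: filterS Vl' => w /nneseries_rearrangement + _.
rewrite integral_nneseries //; last 2 first.
- by move=> i; exact/measurable_EFinP.
- by move=> i w _; rewrite lee_fin sqr_ge0.
have m2 i : (\int[P2]_w (V i w ^+ 2)%:E = (2 / ((theta + 1) * (theta + 2)))%:E)%E.
  have [<- _] := moments i.
  rewrite (integral_preimage P2 (mV i) (f := fun t : R => t ^+ 2)) //.
  by move=> t; exact: sqr_ge0.
have r2 i : (\int[P2]_w ((1 - V i w) ^+ 2)%:E = (theta / (theta + 2))%:E)%E.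
  have [_ <-] := moments i.
  rewrite (integral_preimage P2 (mV i) (f := fun t : R => (1 - t) ^+ 2)) //.
    by apply: measurable_funX; exact: measurable_funB.
  by move=> t; exact: sqr_ge0.
under eq_eseriesr do rewrite (expectation_stick_sq _ Vind mV m2 r2).
have t2 : 0 < theta + 2 by rewrite addr_gt0.
rewrite nneseries_geometric; last first.
  apply/andP; split; first by rewrite divr_ge0 // ltW.
  by rewrite ltr_pdivrMr // mul1r ltrDl.
congr EFin; have t1 : 0 < theta + 1 by rewrite addr_gt0.
have t3 : theta + 2 - theta != 0 by rewrite addrAC subrr add0r.
by field; rewrite t3 !gt_eqF.
Qed.

(** * Moments of the colour masses *)

Lemma variance_bounded01 d (T : measurableType d) (R : realType)
    (P : probability T R) (f : T -> R) (m s : R) : measurable_fun setT f ->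
  (forall x, 0 <= f x <= 1) ->
  (\int[P]_x (f x)%:E = m%:E)%E -> (\int[P]_x (f x ^+ 2)%:E = s%:E)%E ->
  ('V_P[f] = (s - m ^+ 2)%:E)%E.
Proof.
move=> mf f01 Em Es.
have if1 : f \in Lfun P 1 by apply/Lfun1_integrable/integrable_bounded01.
rewrite /variance covarianceE //.
  rewrite unlock Em (_ : \int[P]_w ((f * f)%R w)%:E = s%:E)%E.
    by rewrite -EFinM -EFinB expr2.
  by rewrite -Es; apply: eq_integral => x _; rewrite expr2.
apply/Lfun1_integrable/integrable_bounded01; first exact: measurable_funM.
move=> x; have /andP[f0 f1] := f01 x.
by rewrite /= mulr_ge0 // mulr_ile1.
Qed.

Lemma nneseries_delta (R : realType) (b : nat -> \bar R) (i : nat) :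
  (\sum_(k <oo) (if k == i then b k else 0) = b i)%E.
Proof.
apply: lim_near_cst => //; exists i.+1 => // n /= ni.
rewrite (bigD1_seq i) /= ?eqxx ?iota_uniq ?mem_index_iota //.
by rewrite big1 ?adde0 // => k /negPf ->.
Qed.

Lemma measurable_kcoord (R : realType) (k : nat) (i : nat) (j : 'I_k.+1) :
  measurable_fun setT (fun x : kingman R k => kcoord x i 0 j).
Proof.
move=> _ B mB; rewrite setTI; apply: sub_sigma_algebra.
by exists i, j, B.
Qed.

Lemma kcoord_ge0 (R : realType) (k : nat) (x : kingman R k) i (j : 'I_k.+1) :
  0 <= kcoord x i 0 j.
Proof. by have [/(_ i j)] := set_mem (valP (x : kingman_pts R k)). Qed.

Lemma cvg_l1norm_kcoord (R : realType) (k : nat) (x : kingman R k) :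
  series (fun i => l1norm (kcoord x i)) @ \oo --> (1 : R).
Proof. by have [] := set_mem (valP (x : kingman_pts R k)). Qed.

Lemma l1norm_kcoord (R : realType) (k : nat) (x : kingman R k) i :
  l1norm (kcoord x i) = \sum_j kcoord x i 0 j.
Proof. by apply: eq_bigr => j _; rewrite ger0_norm ?kcoord_ge0. Qed.

Lemma kcoord_le_l1norm (R : realType) (k : nat) (x : kingman R k) i (j : 'I_k.+1) :
  kcoord x i 0 j <= l1norm (kcoord x i).
Proof.
rewrite l1norm_kcoord (bigD1 j) //= lerDl.
by apply: sumr_ge0 => j' _; exact: kcoord_ge0.
Qed.

Lemma cvg_colour_mass (R : realType) (k : nat) (j : 'I_k.+1) (x : kingman R k) :
  cvgn (series (fun i => kcoord x i 0 j)).
Proof.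
apply: series_le_cvg (cvgP _ (cvg_l1norm_kcoord x)) => i.
- exact: kcoord_ge0.
- exact: le_trans (kcoord_ge0 x i j) (kcoord_le_l1norm x i j).
- exact: kcoord_le_l1norm.
Qed.

Lemma colour_mass_bounds (R : realType) (k : nat) (j : 'I_k.+1) (x : kingman R k) :
  0 <= colour_mass j x <= 1.
Proof.
have cj := @cvg_colour_mass R k j x; apply/andP; split.
  apply: limr_ge => //; near=> n.
  by apply: sumr_ge0 => i _; exact: kcoord_ge0.
rewrite -(cvg_lim _ (cvg_l1norm_kcoord x)) //.
apply: ler_lim => //; first exact: cvgP (cvg_l1norm_kcoord x).
near=> n; apply: ler_sum => i _; exact: kcoord_le_l1norm.
Unshelve. all: by end_near.
Qed.

Lemma colour_massE (R : realType) (k : nat) (j : 'I_k.+1) (x : kingman R k) :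
  ((colour_mass j x)%:E = \sum_(i <oo) (kcoord x i 0 j)%:E)%E.
Proof.
rewrite -EFin_lim; last exact: cvg_colour_mass.
by congr (limn _); apply/funext => n; rewrite /= /series /= sumEFin.
Qed.

Lemma sum_l1norm_kcoord (R : realType) (k : nat) (x : kingman R k) :
  (\sum_(i <oo) (l1norm (kcoord x i))%:E = 1)%E.
Proof.
rewrite -(cvg_lim _ (cvg_l1norm_kcoord x)) // -EFin_lim.
  by congr (limn _); apply/funext => n; rewrite /= /series /= sumEFin.
exact: cvgP (cvg_l1norm_kcoord x).
Qed.

Lemma measurable_colour_mass (R : realType) (k : nat) (j : 'I_k.+1) :
  measurable_fun setT (@colour_mass R k j).
Proof.
apply: (measurable_fun_cvg (h := fun n x => series (fun i => kcoord x i 0 j) n)).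
  by move=> n; apply: measurable_sum => i; exact: measurable_kcoord.
by move=> x _; exact: cvg_colour_mass.
Qed.

Lemma double_series_sq (R : realType) (a : nat -> R) (x : R) :
  (forall i, 0 <= a i) -> (\sum_(i <oo) (a i)%:E = x%:E)%E ->
  (\sum_(i <oo) \sum_(n <oo) (a i * a n)%:E = (x ^+ 2)%:E)%E.
Proof.
move=> a0 ax.
have inner i : (\sum_(n <oo) (a i * a n)%:E = x%:E * (a i)%:E)%E.
  rewrite -ax muleC -nneseriesZl; last by move=> n _; rewrite lee_fin.
  by under eq_eseriesr do rewrite EFinM.
under eq_eseriesr do rewrite inner.
by rewrite nneseriesZl ?ax // => i _; rewrite lee_fin.
Qed.

Lemma integral_series d (T : measurableType d) (R : realType)
    (P : {measure set T -> \bar R}) (a : nat -> T -> R) :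
  (forall i, measurable_fun setT (a i)) -> (forall i w, 0 <= a i w) ->
  (\int[P]_w \sum_(i <oo) (a i w)%:E = \sum_(i <oo) \int[P]_w (a i w)%:E)%E.
Proof.
move=> ma a0; rewrite integral_nneseries //; first by move=> i; exact/measurable_EFinP.
by move=> i w _; rewrite lee_fin.
Qed.

Lemma measurable_series d (T : measurableType d) (R : realType)
    (a : nat -> T -> R) :
  (forall i, measurable_fun setT (a i)) -> (forall i w, 0 <= a i w) ->
  measurable_fun setT (fun w => \sum_(i <oo) (a i w)%:E)%E.
Proof.
move=> ma a0; apply: ge0_emeasurable_sum => [i w _ _|i _]; first by rewrite lee_fin.
exact/measurable_EFinP.
Qed.

Lemma integral_double_series_sq d (T : measurableType d) (R : realType)
    (P : {measure set T -> \bar R}) (a : nat -> T -> R) (x : T -> R) :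
  (forall i, measurable_fun setT (a i)) -> (forall i w, 0 <= a i w) ->
  measurable_fun setT x ->
  {ae P, forall w, (\sum_(i <oo) (a i w)%:E = (x w)%:E)%E} ->
  (\int[P]_w (x w ^+ 2)%:E =
   \sum_(i <oo) \sum_(n <oo) \int[P]_w (a i w * a n w)%:E)%E.
Proof.
move=> ma a0 mx ax.
have maa i n : measurable_fun setT (fun w => a i w * a n w) by exact: measurable_funM.
have aa0 i n w : 0 <= a i w * a n w by rewrite mulr_ge0.
have ms i : measurable_fun setT (fun w => \sum_(n <oo) (a i w * a n w)%:E)%E.
  exact: (@measurable_series _ _ _ (fun n w => a i w * a n w)).
have s0 i w : (0 <= \sum_(n <oo) (a i w * a n w)%:E)%E.
  by apply: nneseries_ge0 => n _ _; rewrite lee_fin.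
rewrite (@ae_eq_integral _ _ _ P setT
  (fun w => \sum_(i <oo) \sum_(n <oo) (a i w * a n w)%:E)%E); last 4 first.
- exact: measurableT.
- exact/measurable_EFinP/measurable_funX.
- by apply: ge0_emeasurable_sum.
- by apply: filterS ax => w xw _; rewrite (double_series_sq _ xw).
rewrite integral_nneseries //.
apply: eq_eseriesr => i _.
exact: (integral_series P (maa i) (aa0 i)).
Qed.

(** In the double series of [x ^ 2] the means of the marks are [m ^ 2]
    everywhere, plus [s - m ^ 2] on the diagonal. The first part sums to
    [m ^ 2] times the squared total weight 1, the second one to [s - m ^ 2]
    times the sum of the mean squared weights. *)
Lemma weighted_sum_moments d (T : measurableType d) (R : realType)
    (P : probability T R) (L U : nat -> T -> R) (x : T -> R) (m s t : R) :
  (forall i, measurable_fun setT (L i)) -> (forall i, measurable_fun setT (U i)) ->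
  (forall i w, 0 <= L i w) -> (forall i w, 0 <= U i w) ->
  measurable_fun setT x -> m ^+ 2 <= s ->
  {ae P, forall w, (\sum_(i <oo) (L i w * U i w)%:E = (x w)%:E)%E} ->
  {ae P, forall w, (\sum_(i <oo) (L i w)%:E = 1)%E} ->
  (forall i, \int[P]_w (L i w * U i w)%:E = \int[P]_w (L i w)%:E * m%:E)%E ->
  (forall i n, \int[P]_w ((L i w * L n w) * (U i w * U n w))%:E =
     \int[P]_w (L i w * L n w)%:E * (if n == i then s else m ^+ 2)%:E)%E ->
  (\sum_(i <oo) \int[P]_w (L i w ^+ 2)%:E = t%:E)%E ->
  (\int[P]_w (x w)%:E = m%:E)%E /\
  (\int[P]_w (x w ^+ 2)%:E = (m ^+ 2 + (s - m ^+ 2) * t)%:E)%E.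
Proof.
move=> mL mU L0 U0 mx ms LUx L1 LU LLUU Lt.
have mLU i : measurable_fun setT (fun w => L i w * U i w) by exact: measurable_funM.
have LU0 i w : 0 <= L i w * U i w by rewrite mulr_ge0.
have EL0 i n : (0 <= \int[P]_w (L i w * L n w)%:E)%E.
  by apply: integral_ge0 => w _; rewrite lee_fin mulr_ge0.
have cst1 : (\int[P]_w 1%:E = 1 :> \bar R)%E.
  by rewrite integral_cst // mul1e; exact: probability_setT.
split.
  rewrite (@ae_eq_integral _ _ _ P setT
    (fun w => \sum_(i <oo) (L i w * U i w)%:E)%E); last 4 first.
  - exact: measurableT.
  - exact/measurable_EFinP.
  - exact: (measurable_series mLU LU0).
  - by apply: filterS LUx => w -> _.
  rewrite (integral_series P mLU LU0).
  under eq_eseriesr do rewrite LU muleC.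
  rewrite nneseriesZl; last first.
    by move=> i _; apply: integral_ge0 => w _; rewrite lee_fin.
  rewrite -(integral_series P mL L0) (@ae_eq_integral _ _ _ P setT (fun=> 1%:E)) //.
  - by rewrite cst1 mule1.
  - exact: (measurable_series mL L0).
  - by apply: filterS L1 => w -> _.
rewrite (integral_double_series_sq mLU LU0 mx LUx).
have v0 : 0 <= s - m ^+ 2 by rewrite subr_ge0.
have term i n : (\int[P]_w ((L i w * U i w) * (L n w * U n w))%:E =
    (m ^+ 2)%:E * \int[P]_w (L i w * L n w)%:E +
    (s - m ^+ 2)%:E * (if n == i then \int[P]_w (L i w * L n w)%:E else 0))%E.
  under eq_integral do rewrite mulrACA.
  rewrite LLUU muleC; case: eqP => _; last by rewrite mule0 adde0.
  by rewrite -ge0_muleDl ?lee_fin ?sqr_ge0 // -EFinD addrC subrK.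
have inner i : (\sum_(n <oo) \int[P]_w ((L i w * U i w) * (L n w * U n w))%:E =
    (m ^+ 2)%:E * \sum_(n <oo) \int[P]_w (L i w * L n w)%:E +
    (s - m ^+ 2)%:E * \int[P]_w (L i w ^+ 2)%:E)%E.
  under eq_eseriesr do rewrite term.
  rewrite nneseriesD.
  - rewrite nneseriesZl // nneseriesZl; last by move=> n _; case: ifP.
    by rewrite (nneseries_delta (fun n => \int[P]_w (L i w * L n w)%:E)%E).
  - by move=> n _ _; rewrite mule_ge0 // lee_fin sqr_ge0.
  - by move=> n _ _; rewrite mule_ge0 ?lee_fin //; case: ifP.
under eq_eseriesr do rewrite inner.
have E20 i : (0 <= \int[P]_w (L i w ^+ 2)%:E)%E by exact: EL0.
have S0 i : (0 <= \sum_(n <oo) \int[P]_w (L i w * L n w)%:E)%E.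
  by apply: nneseries_ge0.
rewrite nneseriesD; last 2 first.
- by move=> i _ _; rewrite mule_ge0 // lee_fin sqr_ge0.
- by move=> i _ _; rewrite mule_ge0 // lee_fin.
rewrite !nneseriesZl // Lt.
have mc : measurable_fun setT (fun _ : T => 1 : R) by exact: measurable_cst.
have := integral_double_series_sq mL L0 mc L1.
under eq_integral do rewrite expr1n.
by rewrite cst1 => <-; rewrite mule1.
Qed.

Lemma clamp01_bounds (R : realType) (t : R) : 0 <= Num.min 1 `|t| <= 1.
Proof. by rewrite le_min ler01 normr_ge0 ge_min lexx. Qed.

Lemma clamp01_id (R : realType) (t : R) : 0 <= t <= 1 -> Num.min 1 `|t| = t.
Proof. by move=> /andP[t0 t1]; rewrite ger0_norm // min_r. Qed.

Lemma ucoord_expectation (R : realType) (k : nat) (nu : probability (simplex R k) R)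
    (j : 'I_k.+1) n :
  (\int[nu]_u (ucoord u j ^+ n)%:E = (\int[nu]_u (ucoord u j ^+ n))%R%:E)%E.
Proof.
rewrite /Rintegral fineK //.
have iu : nu.-integrable setT (EFin \o (fun u => ucoord u j ^+ n)).
  apply: integrable_bounded01 => [|u].
    by apply: measurable_funX; exact: measurable_ucoord.
  by rewrite exprn_ge0 ?exprn_ile1 ?ucoord_ge0 ?ucoord_le1.
exact: (integrable_fin_num measurableT iu).
Qed.

Lemma variance_ucoord (R : realType) (k : nat) (nu : probability (simplex R k) R)
    (j : 'I_k.+1) :
  ('V_nu[fun u : simplex R k => ucoord u j] =
   ((\int[nu]_u (ucoord u j ^+ 2))%R - (\int[nu]_u ucoord u j)%R ^+ 2)%:E)%E.
Proof.
apply: variance_bounded01.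
- exact: measurable_ucoord.
- by move=> u; rewrite ucoord_ge0 ucoord_le1.
- have := ucoord_expectation nu j 1; under eq_integral do rewrite expr1.
  by move=> ->; congr EFin; apply: eq_Rintegral => u _; rewrite expr1.
- exact: ucoord_expectation.
Qed.

(** The marks lie on the simplex, so the weights can be read off as the
    [l1norm] of the points of the Kingman simplex; there they inherit their
    sign and their sum. *)
Lemma kingman_decomposition (R : realType) (k : nat) (x : kingman R k)
    (l : nat -> R) (p : nat -> simplex R k) :
  kcoord x 0 = 0 -> (forall i j, kcoord x i.+1 0 j = l i * ucoord (p i) j) ->
  [/\ forall i, 0 <= l i <= 1, (\sum_(i <oo) (l i)%:E = 1)%E &
      forall j, (\sum_(i <oo) (l i * ucoord (p i) j)%:E = (colour_mass j x)%:E)%E].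
Proof.
move=> x0 xS.
have lE i : l i = l1norm (kcoord x i.+1).
  rewrite l1norm_kcoord; under eq_bigr do rewrite xS.
  by rewrite -mulr_sumr sum_ucoord mulr1.
have n0 i : 0 <= l1norm (kcoord x i) by apply: sumr_ge0 => j _.
have shift (f : nat -> R) : (forall i, 0 <= f i) -> f 0%N = 0 ->
    (\sum_(i <oo) (f i)%:E = \sum_(i <oo) (f i.+1)%:E)%E.
  move=> f0 f00; rewrite nneseries_recl //; last by move=> i _; rewrite lee_fin.
  rewrite f00 add0e -(@nneseries_addn _ (fun i => (f i)%:E)).
    by apply: eq_eseriesr => i _; rewrite addn1.
  by move=> i; rewrite lee_fin.
have n00 : l1norm (kcoord x 0) = 0.
  by rewrite x0 /l1norm big1 // => j _; rewrite mxE normr0.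
have sl : (\sum_(i <oo) (l i)%:E = 1)%E.
  under eq_eseriesr do rewrite lE.
  by rewrite -(shift (fun i => l1norm (kcoord x i))) // sum_l1norm_kcoord.
split=> //.
- move=> i; rewrite {1}lE n0 /= -lee_fin -sl.
  have l0 n : (0 <= (l n)%:E)%E by rewrite lee_fin lE.
  apply: le_trans (nneseries_lim_ge i.+1 _) => //.
  by rewrite big_mkord big_ord_recr /= leeDr // sume_ge0.
- move=> j; rewrite colour_massE shift; last 2 first.
  + by move=> i; exact: kcoord_ge0.
  + by rewrite x0 mxE.
  by apply: eq_eseriesr => i _; rewrite xS.
Qed.

Lemma colour_mass_moments (R : realType) (k : nat) (theta : R)
    (nu : probability (simplex R k) R) (Pi : probability (kingman R k) R)
    (j : 'I_k.+1) : 0 < theta -> is_Pi theta nu Pi ->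
  let m := (\int[nu]_u ucoord u j)%R in
  let s := (\int[nu]_u (ucoord u j ^+ 2))%R in
  (\int[Pi]_x (colour_mass j x)%:E = m%:E)%E /\
  (\int[Pi]_x (colour_mass j x ^+ 2)%:E =
     (m ^+ 2 + (s - m ^+ 2) * (theta + 1)^-1)%:E)%E.
Proof.
move=> t0 [d [T [P [l [p [X [pd [pind plaw] lp Xae PiX]]]]]]] m s.
have mX : measurable_fun setT X by exact: measurable_funPT.
have ml : measurable_fun setT l by exact: measurable_funPT.
have mp : measurable_fun setT p by exact: measurable_funPT.
have mD := @measurable_colour_mass R k j.
have PiE (f : kingman R k -> R) : measurable_fun setT f -> (forall x, 0 <= f x) ->
    (\int[Pi]_x (f x)%:E = \int[P]_w (f (X w))%:E)%E.
  move=> mf f0; rewrite -(integral_preimage P mX mf f0).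
  by apply: eq_measure_integral => A mA _; exact: PiX.
have D0 x : 0 <= @colour_mass R k j x by have /andP[] := colour_mass_bounds j x.
rewrite PiE // (PiE (fun x => colour_mass j x ^+ 2)); last 2 first.
- exact: measurable_funX.
- by move=> x; exact: sqr_ge0.
(* The weights lie in [[0, 1]] only almost surely; the truncation [c] makes
   them bounded everywhere without changing them almost surely. *)
pose c (t : R) := Num.min 1 `|t|.
have c0 t : 0 <= c t by have /andP[] := clamp01_bounds t.
have mc : measurable_fun setT c.
  by apply: measurable_minr => //; exact: normr_measurable.
have mci i : measurable_fun setT (fun y : seqspace R => c (y i)).
  exact: (measurableT_comp mc (@measurable_seq_coord _ R i)).
have mui i : measurable_fun setT (fun y : seqspace (simplex R k) => ucoord (y i) j).
  exact: (measurableT_comp (@measurable_ucoord R k j) (@measurable_seq_coord _ _ i)).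
have mpi i : measurable_fun setT (fun w => p w i).
  exact: (measurableT_comp (@measurable_seq_coord _ _ i) mp).
pose L i w := c (l w i); pose U i w := ucoord (p w i) j.
have mL i : measurable_fun setT (L i) by exact: (measurableT_comp (mci i) ml).
have mU i : measurable_fun setT (U i) by exact: (measurableT_comp (mui i) mp).
have L01 i w : 0 <= L i w <= 1 by exact: clamp01_bounds.
have L0 i w : 0 <= L i w by exact: c0.
have U0 i w : 0 <= U i w by exact: ucoord_ge0.
have Ulaw n i : (\int[P]_w (U i w ^+ n)%:E = (\int[nu]_u (ucoord u j ^+ n))%R%:E)%E.
  rewrite -ucoord_expectation.
  rewrite -(integral_preimage P (mpi i) (f := fun u => ucoord u j ^+ n)).
  - by apply: eq_measure_integral => A mA _; exact: plaw.
  - by apply: measurable_funX; exact: measurable_ucoord.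
  - by move=> u; rewrite exprn_ge0 // ucoord_ge0.
have U1 i : (\int[P]_w (U i w)%:E = m%:E)%E.
  have := Ulaw 1%N i; under eq_integral do rewrite expr1.
  by move=> ->; congr EFin; apply: eq_Rintegral => u _; rewrite expr1.
have U2 i : (\int[P]_w (U i w ^+ 2)%:E = s%:E)%E by exact: Ulaw.
have UU i n : (\int[P]_w (U i w * U n w)%:E = (if n == i then s else m ^+ 2)%:E)%E.
  case: eqVneq => [->|ni].
    by rewrite -(U2 i); apply: eq_integral => w _; rewrite expr2.
  have uin : uniq [:: i; n] by rewrite /= inE eq_sym ni.
  have := expectation_mutually_independent pind mpi
    (fun _ => @measurable_ucoord R k j) (fun _ u => ucoord_ge0 u j) U1 uin.
  rewrite !big_cons big_nil mulr1 -expr2 => <-.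
  by apply: eq_integral => w _; rewrite !big_cons big_nil mulr1.
have fin01 (f : T -> R) : measurable_fun setT f -> (forall w, 0 <= f w <= 1) ->
    (\int[P]_w (f w)%:E < +oo)%E.
  move=> mf f01; rewrite -ge0_fin_numE.
    exact: (integrable_fin_num measurableT (integrable_bounded01 P mf f01)).
  by apply: integral_ge0 => w _; rewrite lee_fin; have /andP[] := f01 w.
have ms : m ^+ 2 <= s.
  by rewrite -subr_ge0 -lee_fin -variance_ucoord variance_ge0.
apply: (@weighted_sum_moments _ _ _ P L U) => //.
- exact: (measurableT_comp mD mX).
- apply: filterS Xae => w [x0 xS].
  have [l01 _ /(_ j) <-] := kingman_decomposition x0 xS.
  by apply: eq_eseriesr => i _; rewrite /L /c clamp01_id.
- apply: filterS Xae => w [x0 xS].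
  have [l01 <- _] := kingman_decomposition x0 xS.
  by apply: eq_eseriesr => i _; rewrite /L /c clamp01_id.
- move=> i; rewrite -(U1 i).
  apply: (expectation_independent lp ml mp (mci i) (mui i)) => //.
  - by move=> y; exact: ucoord_ge0.
  - exact: (fin01 (L i) (mL i) (L01 i)).
- move=> i n; rewrite -UU.
  apply: (expectation_independent lp ml mp (measurable_funM (mci i) (mci n))
    (measurable_funM (mui i) (mui n))).
  - by move=> y; exact: mulr_ge0.
  - by move=> y; apply: mulr_ge0; exact: ucoord_ge0.
  - apply: (fin01 (fun w => L i w * L n w)); first exact: measurable_funM.
    move=> w; have /andP[a0 a1] := L01 i w; have /andP[b0 b1] := L01 n w.
    by rewrite mulr_ge0 // mulr_ile1.
- rewrite -(poisson_dirichlet_sum_sq t0 pd); apply: eq_eseriesr => i _.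
  apply: ae_eq_integral => //.
  - exact/measurable_EFinP/measurable_funX.
  - apply/measurable_EFinP/measurable_funX.
    exact: (measurableT_comp (@measurable_seq_coord _ R i) ml).
  - apply: filterS Xae => w [x0 xS] _.
    have [l01 _ _] := kingman_decomposition x0 xS.
    by rewrite /L /c clamp01_id.
Qed.

Theorem corollary5p46 (R : realType) (k : nat) (theta : R)
    (nu : probability (simplex R k) R) :
  0 < theta ->
  (forall (Pi : probability (kingman R k) R), is_Pi theta nu Pi ->
     forall j : 'I_k.+1,
       ('E_Pi[colour_mass j] = (moment nu (munit j))%:E)%E /\
       ('V_Pi[colour_mass j] =
          'V_nu[fun u : simplex R k => ucoord u j] / (theta + 1)%:E)%E) /\
  (partially_exchangeable_type (pESF theta nu) <->
   exists p : simplex R k, same_law nu (\d_p)).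
Proof.
move=> t0; split; last first.
  split; first exact: dirac_of_exchangeable.
  by move=> [p nup]; exact: pESF_dirac nup.
move=> Pi PiP j; have [E1 E2] := colour_mass_moments j t0 PiP.
split; first by rewrite unlock E1 -moment_munit.
rewrite (variance_bounded01 (@measurable_colour_mass R k j) _ E1 E2); last first.
  exact: colour_mass_bounds.
rewrite variance_ucoord inver gt_eqF ?addr_gt0 // -EFinM; congr EFin.
by rewrite addrAC subrr add0r.
Qed.
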